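(* Let $E$ be a separable Banach space and let $\mathbf{G}$ be the separable Gurarij space. Let $\mathrm{Emb}(E,\mathbf{G})$ be the set of linear isometric embeddings $E \to \mathbf{G}$, on which the group $\mathrm{Aut}(\mathbf{G})$ of linear isometric automorphisms of $\mathbf{G}$ acts by composition, and equip $\mathrm{Emb}(E,\mathbf{G})$ and $\mathrm{Aut}(\mathbf{G})$ with the topology of point-wise convergence (the strong operator topology). (1) The space $\mathrm{Emb}(E,\mathbf{G})$ is Polish, the action $\mathrm{Aut}(\mathbf{G}) \curvearrowright \mathrm{Emb}(E,\mathbf{G})$ is continuous and all its orbits are dense. (2) If $\mathbf{G}[E]$ exists, then the set of atomic embeddings $\varphi \in \mathrm{Emb}(E,\mathbf{G})$ is a dense $G_\delta$ orbit under this action. (3) If $\mathbf{G}[E]$ does not exist, then there are no atomic embeddings and all orbits are meagre.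
   Context: All spaces are real; embeddings, isomorphisms and automorphisms of normed spaces are linear and isometric. Types. For a Banach space $E$ and $n \in \mathbb{N}$, let $E(n) = E \oplus \bigoplus_{i<n} \mathbb{R} x_i$, with formal variables $x_i$. The space of $n$-types $S_n(E)$ is the set of all semi-norms on $E(n)$ extending the norm of $E$; the semi-norm corresponding to $\xi \in S_n(E)$ is written $\|\cdot\|^\xi$. If $E \subseteq F$ are Banach spaces and $\bar a \in F^n$, then $\mathrm{tp}(\bar a/E) \in S_n(E)$ is the semi-norm $b + \sum \lambda_i x_i \mapsto \| b + \sum \lambda_i a_i \|$; $\bar a$ realises $\xi$ if $\xi = \mathrm{tp}(\bar a/E)$. The topology on $S_n(E)$ is the least one making $\xi \mapsto \|x\|^\xi$ continuous for every $x \in E(n)$. The distance $d(\xi,\zeta)$ is the infimum, over all Banach spaces $F \supseteq E$ and all realisations $\bar a,\bar b \in F^n$ of $\xi,\zeta$ respectively, of $\sup_i \|a_i - b_i\|$. A type $\xi$ is isolated if every metric neighbourhood of $\xi$ is also a neighbourhood of $\xi$ in the topology. For $E \subseteq F$, $F$ is atomic over $E$ if the type over $E$ of every finite tuple in $F$ is isolated. A Gurarij space is a Banach space $G$ such that for any $\varepsilon > 0$, finite-dimensional Banach spaces $E \subseteq F$ and isometric embedding $\varphi \colon E \to G$, there is a linear map $\psi \colon F \to G$ extending $\varphi$ with $(1-\varepsilon)\|x\| \leq \|\psi x\| \leq (1+\varepsilon)\|x\|$ for all $x \in F$. The separable Gurarij space exists and is unique up to isometric isomorphism; it is denoted $\mathbf{G}$.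 For a separable Banach space $E$, $\mathbf{G}[E]$ denotes the (unique up to isometric isomorphism over $E$) separable Gurarij space containing $E$ and atomic over $E$; ''$\mathbf{G}[E]$ exists'' means that such a space exists. An embedding $\varphi \in \mathrm{Emb}(E,\mathbf{G})$ is atomic if $\mathbf{G}$ is atomic over $\varphi E$. *)

(* Defs.v *)
From HB Require Import structures.
From mathcomp Require Import all_boot all_order all_algebra.
From mathcomp Require Import all_classical all_reals all_analysis.
From mathcomp Require Import borel_hierarchy.

Set Implicit Arguments.
Unset Strict Implicit.
Unset Printing Implicit Defensive.

Import Order.TTheory GRing.Theory Num.Theory.
Import numFieldNormedType.Exports.

Local Open Scope classical_set_scope.
Local Open Scope ring_scope.

Section Topology.
Context {T : topologicalType}.

Definition separable_space := exists2 D : set T, countable D & dense D.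

Definition nowhere_dense (A : set T) := interior (closure A) = set0.

Definition meagre (A : set T) :=
  exists2 N : (set T)^nat, (forall k, nowhere_dense (N k)) &
    A `<=` \bigcup_k N k.

Definition complete_metrization {R : realType} (d : T -> T -> R) :=
  [/\ (forall x y, d x y = 0 <-> x = y),
      (forall x y, d x y = d y x),
      (forall x y z, d x z <= d x y + d y z),
      (forall x (A : set T), nbhs x A <->
         exists2 e : R, 0 < e & [set y | d x y < e] `<=` A) &
      (forall u : nat -> T,
         (forall e : R, 0 < e -> exists N : nat, forall m n : nat,
            (N <= m)%N -> (N <= n)%N -> d (u m) (u n) < e) ->
         exists l : T, u @ \oo --> l)].

End Topology.
Arguments separable_space T : clear implicits.

Definition polish (R : realType) (T : topologicalType) :=
  separable_space T /\ exists d : T -> T -> R, complete_metrization d.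

Definition linear_isometry {R : realType} {E F : normedModType R} (f : E -> F) :=
  linear f /\ forall x, `|f x| = `|x|.

(* [set_type] of a subset of [{ptws _ -> _}] carries the subspace topology,
   hence below the topology of point-wise convergence. *)
Definition Emb {R : realType} (E F : normedModType R) : Type :=
  set_type [set f : {ptws E -> F} | linear_isometry f].

Definition Aut {R : realType} (G : normedModType R) : Type :=
  set_type [set f : {ptws G -> G} | linear_isometry f /\ bijective f].

HB.instance Definition _ (R : realType) (E F : normedModType R) :=
  Topological.copy (Emb E F)
    (set_type [set f : {ptws E -> F} | linear_isometry f]).

HB.instance Definition _ (R : realType) (G : normedModType R) :=
  Topological.copy (Aut G)
    (set_type [set f : {ptws G -> G} | linear_isometry f /\ bijective f]).

Definition emb_fun {R : realType} {E F : normedModType R} (f : Emb E F) :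
  E -> F := \val f.
Coercion emb_fun : Emb >-> Funclass.

Definition aut_fun {R : realType} {G : normedModType R} (s : Aut G) :
  G -> G := \val s.
Coercion aut_fun : Aut >-> Funclass.

Section Action.
Context {R : realType} {E G : normedModType R}.
Implicit Types (s : Aut G) (f : Emb E G).

Lemma aut_act_subproof s f : linear_isometry (s \o f).
Proof.
have [[slin siso] _] := set_mem (valP s); have [flin fiso] := set_mem (valP f).
split=> [a x y|x] /=; last by rewrite [LHS]siso fiso.
by rewrite /aut_fun /emb_fun flin slin.
Qed.

Definition aut_act s f : Emb E G :=
  exist _ (s \o f : {ptws E -> G}) (mem_set (aut_act_subproof s f)).

Definition emb_orbit f : set (Emb E G) := [set aut_act s f | s in [set: Aut G]].

End Action.

Section Types.
Context {R : realType}.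

Definition seminorm {V : lmodType R} (p : V -> R) :=
  (forall x y, p (x + y) <= p x + p y) /\ (forall a x, p (a *: x) = `|a| * p x).

(* [(b, l) : E * 'rV[R]_n] stands for b + \sum_i l_i x_i in E(n). *)
Definition ntype (E : normedModType R) (n : nat) : Type :=
  set_type [set p : {ptws (E * 'rV[R]_n)%type -> R} |
    seminorm p /\ forall b : E, p (b, 0) = `|b|].

HB.instance Definition _ (E : normedModType R) (n : nat) :=
  Topological.copy (ntype E n)
    (set_type [set p : {ptws (E * 'rV[R]_n)%type -> R} |
      seminorm p /\ forall b : E, p (b, 0) = `|b|]).

(* An inclusion E <= F of Banach spaces is given by an isometric embedding
   [j : Emb E F], and the types over the subspace j E are identified with the
   types over E along j. *)
Definition tp_fun {E F : normedModType R} {n : nat} (j : Emb E F)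
    (a : 'I_n -> F) (z : E * 'rV[R]_n) : R :=
  `|j z.1 + \sum_(i < n) z.2 0 i *: a i|.

Lemma tp_subproof {E F : normedModType R} {n : nat} (j : Emb E F)
    (a : 'I_n -> F) :
  seminorm (tp_fun j a) /\ forall b : E, tp_fun j a (b, 0) = `|b|.
Proof.
have [jlin jiso] := set_mem (valP j); rewrite /tp_fun /emb_fun.
have jD x y : \val j (x + y) = \val j x + \val j y.
  by have := jlin 1 x y; rewrite !scale1r.
have j0 : \val j 0 = 0 by apply: (addrI (\val j 0)); rewrite -jD !addr0.
have jZ c x : \val j (c *: x) = c *: \val j x.
  by rewrite -[c *: x]addr0 jlin j0 addr0.
split; first split.
- move=> x y /=; rewrite (le_trans _ (ler_normD _ _))// addrACA -jD.
  rewrite -big_split /= le_eqVlt; apply/orP; left; apply/eqP.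
  by do 2 f_equal; apply: eq_bigr => i _; rewrite !mxE scalerDl.
- move=> c x /=; rewrite -normrZ scalerDr jZ scaler_sumr.
  by do 2 f_equal; apply: eq_bigr => i _; rewrite !mxE scalerA.
- move=> b /=; rewrite big1 ?addr0 ?jiso // => i _.
  by rewrite mxE scale0r.
Qed.

Definition tp {E F : normedModType R} {n : nat} (j : Emb E F)
    (a : 'I_n -> F) : ntype E n :=
  exist _ (tp_fun j a : {ptws (E * 'rV[R]_n)%type -> R})
    (mem_set (tp_subproof j a)).

Definition tuple_dist {F : normedModType R} {n : nat} (a b : 'I_n -> F) : R :=
  \big[Num.max/0]_(i < n) `|a i - b i|.

(* Over realisations in a common extension F of E; [ereal_inf] makes the
   infimum of an empty set +oo. *)
Definition type_dist {E : completeNormedModType R} {n : nat}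
    (xi zeta : ntype E n) : \bar R :=
  ereal_inf [set r : \bar R |
    exists (F : completeNormedModType R) (j : Emb E F) (a b : 'I_n -> F),
      [/\ tp j a = xi, tp j b = zeta & r = (tuple_dist a b)%:E]].

Definition isolated_type {E : completeNormedModType R} {n : nat} (xi : ntype E n) :=
  forall e : R, 0 < e ->
    nbhs xi [set zeta : ntype E n | (type_dist xi zeta < e%:E)%E].

Definition atomic_over {E F : completeNormedModType R} (j : Emb E F) :=
  forall (n : nat) (a : 'I_n -> F), isolated_type (tp j a).

Definition finite_dimensional (V : lmodType R) :=
  exists (n : nat) (v : 'I_n -> V),
    forall x : V, exists c : 'I_n -> R, x = \sum_(i < n) c i *: v i.

Definition gurarij (G : completeNormedModType R) :=
  forall (e : R), 0 < e ->
  forall E F : completeNormedModType R,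
    finite_dimensional E -> finite_dimensional F ->
  forall (i : Emb E F) (phi : Emb E G),
    exists psi : {linear F -> G}, (forall x : E, psi (i x) = phi x) /\
      forall y : F, (1 - e) * `|y| <= `|psi y| <= (1 + e) * `|y|.

(* "G[E] exists", for separable E. *)
Definition atomic_gurarij_exists (E : completeNormedModType R) :=
  exists (H : completeNormedModType R) (j : Emb E H),
    [/\ separable_space H, gurarij H & atomic_over j].

End Types.

(* Main.v *)
From HB Require Import structures.
Require Import Defs.
From mathcomp Require Import all_boot all_order all_algebra.
From mathcomp Require Import all_classical all_reals all_analysis.
From mathcomp Require Import borel_hierarchy.
From mathcomp Require Import ring lra.

(** The proof is a back-and-forth argument, carried out with approximate
    equality of types.

    The distance between two types over [E] equals the uniform distance of their
    seminorms ([type_dist_le], [type_dist_close]). The non-trivial half is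
    [amalgamation]: two seminormed spaces that almost agree along a third one
    embed in a common Banach space where they almost meet. The Banach space is
    obtained by realising a seminorm through its dominated functionals
    ([seminorm_realize]), with Hahn-Banach supplying enough of them.

    Amalgamation and the Gurarij property combine into [forth]: if tuples in [H]
    and in [G] have almost the same type over [E], and the type of a longer tuple
    in [H] is isolated, the latter is copied into [G] with an arbitrarily small
    error, while the old points move by about the old error. Errors shrink
    geometrically, so the moves are summable, and in the limit
    [back_and_forth] gives an isometry of [H] onto [G] which respects the two
    embeddings of [E] and almost respects the given tuples. Isolation is used
    only for tuples from a fixed dense sequence, and it is automatic over the zero
    space.

    Over the zero space, this proves that separable Gurarij spaces are
    isomorphic ([gurarij_unique]), and that any two embeddings of [E] can be
    matched on finitely many points up to a small error, that is, all orbits are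
    dense ([emb_orbit_dense]). Over [E], it proves that the embeddings for which
    the tuples from a dense sequence have isolated types form at most one orbit
    ([densely_isolated_orbit]). If [G[E]] exists, it is isomorphic to [G], so an
    atomic embedding exists and this orbit is that of the atomic embeddings.
    Isolation of a type is a countable conjunction of open conditions, namely
    having neighbourhoods of small diameter, so the orbit is a [G_delta] set.

    If there are no atomic embeddings, every orbit consists of embeddings over
    which one fixed non-isolated type [xi] is realised. Those that realise [xi]
    close to a given tuple of the dense sequence form a nowhere dense set
    ([realizing_nowhere_dense]): running only the forth direction
    ([gurarij_universal]), any type close to [xi] is realised over some embedding
    near a given one, and if the set were somewhere dense then all these types
    would be metrically close to [xi], making it isolated. *)

Set Implicit Arguments.
Unset Strict Implicit.
Unset Printing Implicit Defensive.

Import Order.TTheory GRing.Theory Num.Theory.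
Import numFieldNormedType.Exports.

Local Open Scope classical_set_scope.
Local Open Scope ring_scope.

(** * Sublinear functionals and the Hahn-Banach theorem *)

Section InfFam.
Context {R : realType} {C : Type}.
Implicit Types (F : C -> R).

Definition infi F : R := inf (range F).

Lemma infi_le F m c : (forall c', m <= F c') -> infi F <= F c.
Proof.
by move=> Fm; apply: ge_inf; [exists m => _ [c' _ <-]|exists c].
Qed.

Lemma infi_ge F m (c0 : C) : (forall c, m <= F c) -> m <= infi F.
Proof.
by move=> Fm; apply: lb_le_inf; [exists (F c0), c0|move=> _ [c _ <-]].
Qed.

End InfFam.

Lemma infi_add {R : realType} {C D : Type} (F : C -> R) (G : D -> R) m
    (c0 : C) (d0 : D) :
  (forall c d, m <= F c + G d) -> m <= infi F + infi G.
Proof.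
move=> FG; rewrite -lerBlDl; apply: infi_ge => // d.
by rewrite lerBlDr -lerBlDl; apply: infi_ge => // c; rewrite lerBlDl addrC.
Qed.

Section Sublinear.
Context {R : realType} {V : lmodType R}.
Implicit Types (p q : V -> R) (x y : V).

Definition sublinear q :=
  (forall x y, q (x + y) <= q x + q y) /\
  (forall (a : R) x, 0 <= a -> q (a *: x) = a * q x).

Lemma sublinear0 q : sublinear q -> q 0 = 0.
Proof. by case=> _ qZ; have := qZ 0 0 (lexx _); rewrite scale0r mul0r. Qed.

Lemma sublinear_geN q x : sublinear q -> - q (- x) <= q x.
Proof.
move=> qs; rewrite -subr_ge0 opprK -(sublinear0 qs) -(addrN x).
by case: qs => qD _; exact: qD.
Qed.

(** The largest sublinear functional below [q] whose value at [- y] is at most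
    [- q y]; a functional that is minimal among the sublinear ones therefore
    satisfies [q (- y) = - q y]. *)
Definition slope q y x :=
  infi (fun t : R => q (x + (`|t| : R) *: y) - (`|t| : R) * q y).

Lemma slope_lb q y x (t : R) : sublinear q ->
  - q (- x) <= q (x + (`|t| : R) *: y) - (`|t| : R) * q y.
Proof.
move=> [qD qZ]; rewrite -qZ//.
have := qD (- x) (x + (`|t| : R) *: y); rewrite addKr; lra.
Qed.

Lemma slope_le q y x (t : R) : sublinear q -> 0 <= t ->
  slope q y x <= q (x + t *: y) - t * q y.
Proof.
move=> qs t0; have := infi_le t (fun t' => slope_lb y x t' qs).
by rewrite ger0_norm.
Qed.

Lemma slope_ge q y x m :
  (forall t : R, 0 <= t -> m <= q (x + t *: y) - t * q y) -> m <= slope q y x.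
Proof. by move=> h; apply: (infi_ge (0 : R)) => t; exact: h. Qed.

Lemma slope_le_self q y x : sublinear q -> slope q y x <= q x.
Proof.
by move=> qs; have := slope_le y x qs (lexx 0); rewrite scale0r addr0 mul0r subr0.
Qed.

Lemma slope_opp q y : sublinear q -> slope q y (- y) <= - q y.
Proof.
move=> qs; have := slope_le y (- y) qs ler01.
by rewrite scale1r addNr (sublinear0 qs) mul1r sub0r.
Qed.

Lemma slope_sublinear q y : sublinear q -> sublinear (slope q y).
Proof.
move=> qs; have [qD qZ] := qs; split=> [x z|a x].
  apply: (infi_add (0 : R) (0 : R)) => c d.
  apply: (le_trans (slope_le _ _ qs (addr_ge0 (normr_ge0 c) (normr_ge0 d)))).
  rewrite scalerDl addrACA mulrDl.
  have := qD (x + (`|c| : R) *: y) (z + (`|d| : R) *: y); lra.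
rewrite le_eqVlt => /predU1P[<-|a0].
  rewrite scale0r mul0r; apply/le_anti/andP; split.
    by rewrite -[leRHS](sublinear0 qs); exact: slope_le_self.
  apply: slope_ge => t t0; rewrite add0r qZ//; lra.
apply/le_anti/andP; split.
  rewrite mulrC -ler_pdivrMr//; apply: slope_ge => t t0.
  rewrite ler_pdivrMr//.
  apply: (le_trans (slope_le _ _ qs (mulr_ge0 (ltW a0) t0))).
  rewrite -scalerA -scalerDr qZ ?(ltW a0)//.
  by rewrite le_eqVlt; apply/orP; left; apply/eqP; ring.
apply: slope_ge => t t0.
have ta : 0 <= a^-1 * t by rewrite mulr_ge0// invr_ge0 ltW.
have -> : t = a * (a^-1 * t) by rewrite mulrA divff ?mul1r ?gt_eqF.
rewrite -scalerA -scalerDr qZ ?(ltW a0)// -mulrA -mulrBr ler_pM2l//.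
exact: slope_le.
Qed.

Let below p := {q : V -> R | sublinear q /\ forall x, q x <= p x}.

(** Along a chain the pointwise infimum stays sublinear, because each member is
    bounded below by [- p (- x)]; Zorn then applies. *)
Lemma sublinear_minimal p : sublinear p ->
  exists2 q, sublinear q /\ (forall x, q x <= p x) &
    forall r, sublinear r -> (forall x, r x <= q x) -> r = q.
Proof.
move=> ps.
have [|t1 t2 t3 h12 h23|s t /asboolP h1 /asboolP h2|A totA|[q qP] qmin] :=
  @Zorn (below p) (fun r s => `[< forall x, sval s x <= sval r x >]).
- by move=> t; exact/asboolP.
- apply/asboolP => x; apply: le_trans (asboolP _ h12 x).
  by move/asboolP : h23; exact.
- by apply: eq_sig_hprop => [?|]; [exact: Prop_irrelevance|];
    apply/funext => x; apply/le_anti; rewrite h1 h2.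
- have [[a0 Aa0]|A0] := pselect (exists a, A a); last first.
    exists (exist _ p (conj ps (fun=> lexx _))) => s As.
    by case: A0; exists s.
  pose F x (a : A) : R := sval (sval a) x.
  have Flb x (a : A) : - p (- x) <= F x a.
    have [as_ alep] := svalP (sval a).
    apply: le_trans (sublinear_geN x as_); rewrite lerN2; exact: alep.
  pose a0' : A := exist _ a0 (mem_set Aa0).
  pose q x := infi (F x).
  have qle x (a : A) : q x <= F x a by apply: infi_le => a'; exact: Flb.
  have qs : sublinear q.
    split=> [x y|a x a_ge0].
      apply: (infi_add a0' a0') => b c.
      have [/asboolP bc|/asboolP cb] := totA _ _ (set_mem (valP b)) (set_mem (valP c)).
        apply: (le_trans (qle _ c)); have [[cD _] _] := svalP (sval c).
        by apply: (le_trans (cD _ _)); rewrite lerD2r; exact: bc.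
      apply: (le_trans (qle _ b)); have [[bD _] _] := svalP (sval b).
      by apply: (le_trans (bD _ _)); rewrite lerD2l; exact: cb.
    have FZ b : F (a *: x) b = a * F x b.
      by have [[_ bZ] _] := svalP (sval b); exact: bZ.
    move: a_ge0; rewrite le_eqVlt => /predU1P[a0E|a_gt0].
      rewrite -a0E mul0r; apply/le_anti/andP; split.
        by apply: (le_trans (qle _ a0')); rewrite a0E FZ -a0E mul0r.
      by apply: (infi_ge a0') => b; rewrite a0E FZ -a0E mul0r.
    apply/le_anti/andP; split.
      rewrite mulrC -ler_pdivrMr//; apply: (infi_ge a0') => b.
      by rewrite ler_pdivrMr// mulrC -FZ; exact: qle.
    by apply: (infi_ge a0') => b; rewrite FZ ler_pM2l//; exact: qle.
  have qp x : q x <= p x.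
    by apply: (le_trans (qle _ a0')); have [_ h] := svalP a0; exact: h.
  exists (exist _ q (conj qs qp)) => s As; apply/asboolP => x /=.
  exact: (qle x (exist _ s (mem_set As))).
- have [qs qp] := qP; exists q => // r rs rq.
  have rp x : r x <= p x by apply: le_trans (rq x) (qp x).
  have /(congr1 sval) := qmin (exist _ r (conj rs rp)) (asboolT rq).
  by [].
Qed.

(** Minimality forces [slope q y = q], hence [q (- y) = - q y]; an odd sublinear
    functional is linear. *)
Lemma sublinear_minimal_linear q : sublinear q ->
  (forall r, sublinear r -> (forall x, r x <= q x) -> r = q) -> linear q.
Proof.
move=> qs qmin; have [qD qZ] := qs.
have qN y : q (- y) = - q y.
  apply/le_anti/andP; split; last first.
    by have := sublinear_geN (- y) qs; rewrite opprK.
  rewrite -[X in X (- y) <= _](qmin (slope q y)); first exact: slope_opp.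
    exact: slope_sublinear.
  by move=> x; exact: slope_le_self.
have qDE x y : q (x + y) = q x + q y.
  apply/le_anti; rewrite qD /=.
  have := qD (- x) (- y); rewrite -opprD !qN; lra.
move=> a x y; rewrite qDE; congr (_ + _).
have [a0|a0] := leP 0 a; first exact: qZ.
rewrite -[a in LHS]opprK scaleNr qN qZ ?oppr_ge0 ?ltW// mulNr opprK//.
Qed.

(** Minimising below [slope p x0] instead of [p] is what pins the value at
    [x0]: there the functional is at most [- p x0] at [- x0]. *)
Lemma hahn_banach p x0 : sublinear p ->
  exists f : V -> R, [/\ linear f, forall x, f x <= p x & f x0 = p x0].
Proof.
move=> ps; have [q [qs qp] qmin] := sublinear_minimal (slope_sublinear x0 ps).
have qlin := sublinear_minimal_linear qs qmin.
exists q; split=> //.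
  by move=> x; apply: le_trans (qp x) (slope_le_self x0 x ps).
apply/le_anti/andP; split; first exact: le_trans (qp _) (slope_le_self x0 _ ps).
have qN : q (- x0) = - q x0.
  have := qlin (-1) x0 0; rewrite !scaleN1r addr0 => ->.
  by rewrite (sublinear0 qs) addr0.
rewrite -lerN2 -qN; exact: le_trans (qp _) (slope_opp x0 ps).
Qed.

End Sublinear.

(** * Banach spaces of bounded functions and realisation of seminorms *)

Lemma natSinv_small {R : realType} (e : R) : 0 < e ->
  exists N, forall n, (N <= n)%N -> n.+1%:R^-1 < e.
Proof.
move=> e0; have [N _ Ne] := near_infty_natSinv_lt (PosNum e0).
by exists N => n Nn; exact: (Ne n Nn).
Qed.

Section SeqComplete.
Context {R : realType} {V : normedModType R}.
Implicit Types (u : nat -> V).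

Definition cauchy_seq u := forall e : R, 0 < e ->
  exists N, forall m n, (N <= m)%N -> (N <= n)%N -> `|u m - u n| < e.

Definition seq_limit u (l : V) := forall e : R, 0 < e ->
  exists N, forall n, (N <= n)%N -> `|u n - l| < e.

Definition seq_complete := forall u, cauchy_seq u -> exists l, seq_limit u l.

(** A Cauchy filter and a sequence picked in its members of radius [1 / (n + 1)]
    converge together, so completeness is checked on sequences only. *)
Lemma seq_complete_cvg : seq_complete ->
  forall F : set_system V, ProperFilter F -> cauchy F -> cvg F.
Proof.
move=> Vc F FF /cauchyP Fc.
have e_gt0 n : (0 : R) < n.+1%:R^-1 by rewrite invr_gt0.
have /choice[u Fu] n : exists x, F (ball x (n.+1%:R^-1 : R)).
  exact: Fc.
have close m n : `|u m - u n| < m.+1%:R^-1 + n.+1%:R^-1.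
  have [z []] := filter_ex (filterI (Fu m) (Fu n)).
  rewrite -!ball_normE/= => h1 h2.
  rewrite -(subrKA z); apply: le_lt_trans (ler_normD _ _) _.
  by apply: ltrD => //; rewrite distrC.
have [|l ul] := Vc u.
  move=> e e0; have [N Ne] := natSinv_small (divr_gt0 e0 (ltr0Sn _ 1)).
  exists N => m n /Ne hm /Ne hn; apply: lt_trans (close m n) _.
  by rewrite (splitr e); exact: ltrD.
apply/cvg_ex; exists l; apply/cvgrPdist_lt => e e0.
have e2 : 0 < e / 2 by rewrite divr_gt0.
have [N Ne] := natSinv_small e2; have [M Me] := ul _ e2.
apply: filterS (Fu (maxn N M)) => z; rewrite -ball_normE/= => h.
rewrite (splitr e) -(subrKA (u (maxn N M))).
apply: le_lt_trans (ler_normD _ _) _; apply: ltrD.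
  by rewrite distrC; apply: Me; exact: leq_maxr.
by apply: lt_trans h _; apply: Ne; exact: leq_maxl.
Qed.

End SeqComplete.
Arguments seq_complete {R} V.

Lemma complete_seq_complete {R : realType} (V : completeNormedModType R) :
  seq_complete V.
Proof.
move=> u uc; have /cauchy_cvg/cvg_ex[l ul] : cauchy (u @ \oo).
  apply/cauchyP => e e0; have [N Ne] := uc e e0.
  exists (u N); exists N => // n /= Nn; rewrite -ball_normE/=; exact: Ne.
exists l => e e0; have /cvgrPdist_lt/(_ e e0)[N _ Ne] := ul.
by exists N => n Nn; rewrite distrC; exact: (Ne n Nn).
Qed.

Section Linf.
Context {R : realType} (X : Type).

Definition bounded_fct : {pred X -> R} :=
  fun f => `[< exists M, forall x, `|f x| <= M >].

Lemma bounded_fct_submod : submod_closed bounded_fct.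
Proof.
split=> [|a f g /asboolP[M Mf] /asboolP[N Ng]].
  by apply/asboolP; exists 0 => x; rewrite normr0.
apply/asboolP; exists (`|a| * M + N) => x.
apply: (le_trans (ler_normD _ _)); apply: lerD => //.
by rewrite normrM ler_wpM2l.
Qed.

HB.instance Definition _ :=
  GRing.isSubmodClosed.Build R (X -> R) bounded_fct bounded_fct_submod.

Record linf := Linf { linf_fun :> X -> R; _ : linf_fun \in bounded_fct }.

HB.instance Definition _ := [isSub for linf_fun].
HB.instance Definition _ := [Choice of linf by <:].
HB.instance Definition _ := [SubChoice_isSubLmodule of linf by <:].

Implicit Types f g : linf.

Lemma linf_bounded f : exists M, forall x, `|f x| <= M.
Proof. by case: f => f /= /asboolP. Qed.

(** The point 0 makes the set non-empty for every [X]. *)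
Definition linf_norm f : R := sup (0 |` range (fun x => `|f x|)).

Lemma linf_norm_ub f x : `|f x| <= linf_norm f.
Proof.
apply: ub_le_sup; last by right; exists x.
have [M Mf] := linf_bounded f; exists (Num.max 0 M) => _ [->|[y _ <-]].
  by rewrite le_max lexx.
by rewrite le_max Mf orbT.
Qed.

Lemma linf_norm_le f M : 0 <= M -> (forall x, `|f x| <= M) -> linf_norm f <= M.
Proof.
move=> M0 Mf; apply: ge_sup; first by exists 0; left.
by move=> _ [->|[y _ <-]].
Qed.

Lemma linf_norm_ge0 f : 0 <= linf_norm f.
Proof.
apply: ub_le_sup; last by left.
have [M Mf] := linf_bounded f; exists (Num.max 0 M) => _ [->|[y _ <-]].
  by rewrite le_max lexx.
by rewrite le_max Mf orbT.
Qed.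

Lemma linf_normD f g : linf_norm (f + g) <= linf_norm f + linf_norm g.
Proof.
apply: linf_norm_le => [|x]; first by rewrite addr_ge0// linf_norm_ge0.
by apply: (le_trans (ler_normD _ _)); rewrite lerD// linf_norm_ub.
Qed.

Lemma linf_normZ (a : R) f : linf_norm (a *: f) = `|a| * linf_norm f.
Proof.
apply/le_anti/andP; split.
  apply: linf_norm_le => [|x]; first by rewrite mulr_ge0// linf_norm_ge0.
  by rewrite normrM ler_wpM2l// linf_norm_ub.
have [->|a0] := eqVneq a 0; first by rewrite normr0 mul0r linf_norm_ge0.
rewrite mulrC -ler_pdivlMr ?normr_gt0//; apply: linf_norm_le => [|x].
  by rewrite divr_ge0// linf_norm_ge0.
by rewrite ler_pdivlMr ?normr_gt0// mulrC -normrM; exact: (linf_norm_ub (a *: f)).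
Qed.

Lemma linf_norm0_eq0 f : linf_norm f = 0 -> f = 0.
Proof.
move=> f0; apply: val_inj; apply/funext => x /=; apply/eqP.
by rewrite -normr_le0 -f0 linf_norm_ub.
Qed.

HB.instance Definition _ := Lmodule_isNormed.Build R linf
  linf_normD linf_normZ linf_norm0_eq0.

Lemma linf_seq_complete : seq_complete linf.
Proof.
move=> u uc.
have /choice[g ug] x : exists l : R, seq_limit (u ^~ x) l.
  apply: (@complete_seq_complete R R) => e e0; have [N Ne] := uc e e0.
  exists N => m n Nm Nn. apply: (@le_lt_trans _ _ `|u m - u n|); last exact: Ne.
  exact: (linf_norm_ub (u m - u n)).
have unif (e : R) : 0 < e -> exists N, forall n x, (N <= n)%N -> `|u n x - g x| <= e.
  move=> e0; have [N Ne] := uc e e0; exists N => n x Nn.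
  apply/ler_addgt0Pr => d d0; have [M Me] := ug x d d0.
  rewrite -(subrKA (u (maxn N M) x)) (le_trans (ler_normD _ _))// lerD//.
    apply: ltW; apply: le_lt_trans (Ne n (maxn N M) Nn (leq_maxl _ _)).
    exact: (linf_norm_ub (u n - u _)).
  by apply: ltW; apply: Me; exact: leq_maxr.
have gb : g \in bounded_fct.
  have [N Ne] := unif 1 ltr01; have [M Mu] := linf_bounded (u N).
  apply/asboolP; exists (M + 1) => x.
  by rewrite -[g x](subKr (u N x)) (le_trans (ler_normB _ _))// lerD// Ne.
exists (Linf gb) => e e0; have [N Ne] := unif (e / 2) (divr_gt0 e0 (ltr0Sn _ 1)).
exists N => n Nn; apply: (@le_lt_trans _ _ (e / 2)).
  by apply: linf_norm_le => [|x]; [rewrite divr_ge0// ltW|exact: Ne].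
by rewrite ltr_pdivrMr// ltr_pMr// ltr1n.
Qed.

HB.instance Definition _ :=
  Uniform_isComplete.Build linf (seq_complete_cvg linf_seq_complete).

End Linf.
Arguments linf R X : clear implicits.

Section Realize.
Context {R : realType} {V : lmodType R} (p : V -> R) (p_semi : seminorm p).

Lemma seminorm_sublinear : sublinear p.
Proof.
by case: p_semi => pD pZ; split=> // a x a0; rewrite pZ ger0_norm.
Qed.

Lemma seminormN x : p (- x) = p x.
Proof. by case: p_semi => _ pZ; rewrite -scaleN1r pZ normrN normr1 mul1r. Qed.

Lemma seminorm_ge0 x : 0 <= p x.
Proof.
have := sublinear_geN x seminorm_sublinear; rewrite seminormN; lra.
Qed.

Let dom := {f : V -> R | linear f /\ forall x, f x <= p x}.

Lemma dominated_norm (f : dom) x : `|sval f x| <= p x.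
Proof.
have [flin fp] := svalP f; rewrite ler_norml fp andbT lerNl.
have -> : - sval f x = sval f (- x).
  have := flin (-1) x 0; rewrite !scaleN1r addr0 => ->.
  have := flin (-1) 0 0; rewrite !scaleN1r addr0 oppr0; lra.
by rewrite -seminormN fp.
Qed.

Lemma evaluation_bounded x : (fun f : dom => sval f x) \in @bounded_fct R dom.
Proof. by apply/asboolP; exists (p x) => f; exact: dominated_norm. Qed.

(** Evaluation at the functionals dominated by [p] is linear into the Banach
    space of bounded functions, and Hahn-Banach makes it attain [p]. The kernel
    of [p] is sent to 0 and the target is complete, so this takes the place of
    a separated completion. *)
Lemma seminorm_realize : exists (K : completeNormedModType R) (i : V -> K),
  linear i /\ forall x, `|i x| = p x.
Proof.
exists (linf R dom), (fun x => Linf (evaluation_bounded x)); split.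
  by move=> a x y; apply: val_inj; apply/funext => -[f [flin fp]] /=; exact: flin.
move=> x; apply/le_anti/andP; split.
  apply: linf_norm_le; first exact: seminorm_ge0.
  by move=> f; exact: dominated_norm.
have [f [flin fp fx]] := hahn_banach x seminorm_sublinear.
rewrite -fx; apply: le_trans (ler_norm _) _.
exact: (linf_norm_ub (Linf (evaluation_bounded x)) (exist _ f (conj flin fp))).
Qed.

End Realize.

(** * Amalgamation of seminormed spaces *)

Section LinearFacts.
Context {R : realType} {U V : lmodType R} (f : U -> V) (flin : linear f).

Lemma linD x y : f (x + y) = f x + f y.
Proof. by have := flin 1 x y; rewrite !scale1r. Qed.

Lemma lin0 : f 0 = 0.
Proof. by apply: (addrI (f 0)); rewrite -linD !addr0. Qed.

Lemma linZ a x : f (a *: x) = a *: f x.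
Proof. by rewrite -[a *: x]addr0 flin lin0 addr0. Qed.

Lemma linN x : f (- x) = - f x.
Proof. by rewrite -scaleN1r linZ scaleN1r. Qed.

Lemma linB x y : f (x - y) = f x - f y.
Proof. by rewrite linD linN. Qed.

Lemma lin_sum (I : Type) (r : seq I) (P : pred I) (F : I -> U) :
  f (\sum_(i <- r | P i) F i) = \sum_(i <- r | P i) f (F i).
Proof. by apply: big_morph; [exact: linD|exact: lin0]. Qed.

End LinearFacts.

Section Amalgam.
Context {R : realType} {A B C : lmodType R}.
Context (u : A -> R) (v : B -> R) (w : C -> R) (f : C -> A) (g : C -> B).
Context (us : seminorm u) (vs : seminorm v) (ws : seminorm w).
Context (flin : linear f) (glin : linear g).
Context (close : forall c, `|u (f c) - v (g c)| <= w c).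

(** The largest seminorm on [A * B] that is at most [u] on [A], at most [v] on
    [B] and at most [w c] at [(f c, - g c)]. *)
Definition amalgam (z : A * B) : R :=
  infi (fun c => u (z.1 - f c) + v (z.2 + g c) + w c).

Lemma amalgam_le z c : amalgam z <= u (z.1 - f c) + v (z.2 + g c) + w c.
Proof.
apply: (@infi_le _ _ (fun c => u (z.1 - f c) + v (z.2 + g c) + w c) 0) => c'.
by rewrite !addr_ge0 ?(seminorm_ge0 us) ?(seminorm_ge0 vs) ?(seminorm_ge0 ws).
Qed.

Lemma amalgam_ge z m :
  (forall c, m <= u (z.1 - f c) + v (z.2 + g c) + w c) -> m <= amalgam z.
Proof. exact: (infi_ge (0 : C)). Qed.

Lemma amalgam_seminorm : seminorm amalgam.
Proof.
have [[[uD uZ] [vD vZ]] [wD wZ]] := (us, vs, ws).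
have amZ (a : R) z : a != 0 -> amalgam (a *: z) <= `|a| * amalgam z.
  move=> a0; rewrite mulrC -ler_pdivrMr ?normr_gt0//; apply: amalgam_ge => c.
  rewrite ler_pdivrMr ?normr_gt0//; apply: (le_trans (amalgam_le _ (a *: c))).
  rewrite (linZ flin) (linZ glin) /= -scalerBr -scalerDr uZ vZ wZ.
  by rewrite -!mulrDr mulrC.
split=> [x y|a x].
  apply: (infi_add (0 : C) (0 : C)) => c d; apply: (le_trans (amalgam_le _ (c + d))).
  rewrite (linD flin) (linD glin) /= opprD addrACA [X in _ + v X]addrACA.
  have := uD (x.1 - f c) (y.1 - f d); have := vD (x.2 + g c) (y.2 + g d).
  have := wD c d; lra.
have [->|a0] := eqVneq a 0.
  rewrite scale0r normr0 mul0r; apply/le_anti/andP; split.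
    apply: (le_trans (amalgam_le _ 0)).
    rewrite (lin0 flin) (lin0 glin) /= subr0 addr0.
    have := uZ 0 0; have := vZ 0 0; have := wZ 0 0; rewrite !scale0r normr0 !mul0r.
    by move=> -> -> ->; rewrite !addr0.
  apply: amalgam_ge => c.
  by rewrite !addr_ge0 ?(seminorm_ge0 us) ?(seminorm_ge0 vs) ?(seminorm_ge0 ws).
apply/le_anti/andP; split; first exact: amZ.
rewrite mulrC -ler_pdivlMr ?normr_gt0//.
rewrite -[x in leLHS]scale1r -(mulVf a0) -scalerA.
apply: (le_trans (amZ _ _ _)); first by rewrite invr_eq0.
by rewrite normfV mulrC.
Qed.

(** The bound [close] is what prevents a detour through [C] from shortening an
    element of [A]. *)
Lemma amalgam_l a : amalgam (a, 0) = u a.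
Proof.
have [[[uD uZ] [vD vZ]] [wD wZ]] := (us, vs, ws).
apply/le_anti/andP; split.
  apply: (le_trans (amalgam_le _ 0)); rewrite (lin0 flin) (lin0 glin) /= subr0 addr0.
  have := vZ 0 0; have := wZ 0 0; rewrite !scale0r normr0 !mul0r => -> ->.
  by rewrite !addr0.
apply: amalgam_ge => c /=; rewrite add0r.
have := uD (a - f c) (f c); rewrite subrK.
have := close c; rewrite ler_norml => /andP[_]; lra.
Qed.

Lemma amalgam_r b : amalgam (0, b) = v b.
Proof.
have [[[uD uZ] [vD vZ]] [wD wZ]] := (us, vs, ws).
apply/le_anti/andP; split.
  apply: (le_trans (amalgam_le _ 0)); rewrite (lin0 flin) (lin0 glin) /= subr0 addr0.
  have := uZ 0 0; have := wZ 0 0; rewrite !scale0r normr0 !mul0r => -> ->.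
  by rewrite add0r !addr0.
apply: amalgam_ge => c /=; rewrite sub0r (seminormN us).
have := vD (b + g c) (- g c); rewrite addrK (seminormN vs).
have := close c; rewrite ler_norml => /andP[+ _]; lra.
Qed.

(** As the factors are isometric in the amalgam, it is enough to realise that
    seminorm. The same construction gives the distance between two types (with
    [A = B = C]) and the common extension of two Banach spaces along a tuple
    (with [C] the space of formal combinations of its entries). *)
Lemma amalgamation : exists (K : completeNormedModType R) (i : A -> K) (j : B -> K),
  [/\ linear i, linear j, forall a, `|i a| = u a, forall b, `|j b| = v b &
      forall c, `|i (f c) - j (g c)| <= w c].
Proof.
have [K [k [klin kp]]] := seminorm_realize amalgam_seminorm.
exists K, (fun a => k (a, 0)), (fun b => k (0, b)); split.
- by move=> a x y; rewrite -klin; congr k; apply/pair_equal_spec;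
  rewrite /= scaler0 addr0.
- by move=> a x y; rewrite -klin; congr k; apply/pair_equal_spec;
  rewrite /= scaler0 addr0.
- by move=> a; rewrite kp amalgam_l.
- by move=> b; rewrite kp amalgam_r.
- move=> c; rewrite -(linB klin) kp; apply: (le_trans (amalgam_le _ c)) => /=.
  have [[_ uZ] [_ vZ]] := (us, vs).
  have := uZ 0 0; have := vZ 0 0; rewrite !scale0r normr0 !mul0r => v0 u0.
  by rewrite subr0 subrr sub0r addNr u0 v0 !add0r.
Qed.

End Amalgam.

(** * Finite-dimensional subspaces as Banach spaces *)

Section CompleteSubspace.
Context {R : realType} {K : normedModType R}.
Implicit Types (S : set K) (u : nat -> K).

Lemma seq_limit_uniq u l l' : seq_limit u l -> seq_limit u l' -> l = l'.
Proof.
move=> ul ul'; apply/eqP; rewrite -subr_eq0 -normr_le0.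
apply/ler_addgt0Pr => e e0; have e2 := divr_gt0 e0 (ltr0Sn _ 1).
have [N Ne] := ul _ e2; have [M Me] := ul' _ e2.
rewrite add0r -(subrKA (u (maxn N M))) (le_trans (ler_normD _ _))//.
rewrite (splitr e) lerD// ltW//; last by apply: Me; exact: leq_maxr.
by rewrite distrC; apply: Ne; exact: leq_maxl.
Qed.

Lemma seq_limit_cauchy u l : seq_limit u l -> cauchy_seq u.
Proof.
move=> ul e e0; have [N Ne] := ul _ (divr_gt0 e0 (ltr0Sn _ 1)).
exists N => m n Nm Nn; rewrite -(subrKA l) (le_lt_trans (ler_normD _ _))//.
by rewrite (splitr e) ltrD// ?Ne// distrC Ne.
Qed.

Lemma near_seq_limit l (s : nat -> K) :
  (forall n, `|s n - l| < n.+1%:R^-1) -> seq_limit s l.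
Proof.
move=> sl e e0; have [N Ne] := natSinv_small e0.
by exists N => n Nn; exact: lt_trans (sl n) (Ne n Nn).
Qed.

Definition complete_on S := forall u, (forall n, S (u n)) -> cauchy_seq u ->
  exists2 l, S l & seq_limit u l.

Definition lin_closed S := S 0 /\ forall (a : R) x y, S x -> S y -> S (a *: x + y).

Lemma lin_closedZ S (a : R) x : lin_closed S -> S x -> S (a *: x).
Proof. by move=> [S0 SD] Sx; rewrite -[_ *: _]addr0; exact: SD. Qed.

Lemma lin_closedD S x y : lin_closed S -> S x -> S y -> S (x + y).
Proof. by move=> [S0 SD] Sx Sy; rewrite -[x]scale1r; exact: SD. Qed.

Lemma lin_closedB S x y : lin_closed S -> S x -> S y -> S (x - y).
Proof. by move=> [S0 SD] Sx Sy; rewrite addrC -scaleN1r; exact: SD. Qed.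

Lemma lin_closed_sum S (I : Type) (r : seq I) (P : pred I) (F : I -> K) :
  lin_closed S -> (forall i, S (F i)) -> S (\sum_(i <- r | P i) F i).
Proof.
move=> SL SF; apply: big_ind => //; first by case: SL.
by move=> x y; exact: lin_closedD.
Qed.

(** Otherwise some sequence in [S] tends to [x], and its limit in [S] is [x]. *)
Lemma complete_on_dist S x : complete_on S -> ~ S x ->
  exists2 d : R, 0 < d & forall s, S s -> d <= `|s - x|.
Proof.
move=> Sc Sx; apply: contrapT => noD.
have /choice[s sx] n : exists s, S s /\ `|s - x| < n.+1%:R^-1.
  apply: contrapT => nos; apply: noD; exists n.+1%:R^-1; first by rewrite invr_gt0.
  move=> s Ss; rewrite leNgt; apply/negP => lt; apply: nos; by exists s.
have sl : seq_limit s x by apply: near_seq_limit => n; have [] := sx n.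
have [l Sl sl'] := Sc s (fun n => (sx n).1) (seq_limit_cauchy sl).
by apply: Sx; rewrite (seq_limit_uniq sl sl').
Qed.

(** Away from [x], the coefficient of [x] is controlled by the norm, so a
    Cauchy sequence of sums splits into two Cauchy sequences. *)
Lemma complete_on_adjoin S x : lin_closed S -> complete_on S ->
  complete_on [set z | exists (a : R) s, S s /\ z = a *: x + s].
Proof.
move=> SL Sc u uS uc.
have [Sx|Sx] := pselect (S x).
  have [|l Sl ul] := Sc u _ uc.
    by move=> n; have [a [s [Ss ->]]] := uS n; case: SL => _; exact.
  by exists l => //; exists 0, l; rewrite scale0r add0r.
have [d d0 Sd] := complete_on_dist Sc Sx.
have coefB a s : S s -> `|a| * d <= `|a *: x + s|.
  move=> Ss; have [->|a0] := eqVneq a 0; first by rewrite normr0 mul0r.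
  have -> : a *: x + s = - a *: (- a^-1 *: s - x).
    rewrite scalerBr scalerA mulrNN divff// scale1r !scaleNr opprK.
    by rewrite addrC.
  by rewrite normrZ normrN ler_wpM2l// Sd//; exact: lin_closedZ.
have /choice[as_ uE] n : exists p : R * K, S p.2 /\ u n = p.1 *: x + p.2.
  by have [a [s [Ss us]]] := uS n; exists (a, s).
pose a n := (as_ n).1; pose s n := (as_ n).2.
have aB m n : `|a m - a n| * d <= `|u m - u n|.
  rewrite (uE m).2 (uE n).2 opprD addrACA -scalerBl; apply: coefB.
  by apply: lin_closedB => //; [exact: (uE m).1|exact: (uE n).1].
have ac : @cauchy_seq R R a.
  move=> e e0; have [N Ne] := uc _ (mulr_gt0 e0 d0).
  exists N => m n Nm Nn; rewrite -(ltr_pM2r d0).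
  exact: le_lt_trans (aB m n) (Ne m n Nm Nn).
have sE n : s n = u n - a n *: x by rewrite (uE n).2 addrC addKr.
have sc : cauchy_seq s.
  move=> e e0; have e2 := divr_gt0 e0 (ltr0Sn _ 1).
  have x1 : 0 < `|x| + 1 by rewrite ltr_wpDl.
  have [N Ne] := uc _ e2; have [M Me] := ac _ (divr_gt0 e2 x1).
  exists (maxn N M) => m n; rewrite !geq_max => /andP[Nm Mm] /andP[Nn Mn].
  rewrite !sE opprD addrACA -opprD -scalerBl.
  rewrite (le_lt_trans (ler_normB _ _))// normrZ (splitr e) ltrD ?Ne//.
  apply: (@le_lt_trans _ _ (`|a m - a n| * (`|x| + 1))).
    by rewrite ler_wpM2l// lerDl.
  by rewrite -ltr_pdivlMr// Me.
have [l Sl sl] := Sc s (fun n => (uE n).1) sc.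
have [b ab] := @complete_seq_complete R R a ac.
exists (b *: x + l); first by exists b, l.
move=> e e0; have e2 := divr_gt0 e0 (ltr0Sn _ 1).
have x1 : 0 < `|x| + 1 by rewrite ltr_wpDl.
have [N Ne] := sl _ e2; have [M Me] := ab _ (divr_gt0 e2 x1).
exists (maxn N M) => n; rewrite geq_max => /andP[Nn Mn].
rewrite (uE n).2 opprD addrACA -scalerBl (splitr e).
rewrite (le_lt_trans (ler_normD _ _))// ltrD ?Ne// normrZ.
apply: (@le_lt_trans _ _ (`|a n - b| * (`|x| + 1))).
  by rewrite ler_wpM2l// lerDl.
by rewrite -ltr_pdivlMr// Me.
Qed.

End CompleteSubspace.

Section Span.
Context {R : realType} {K : normedModType R}.

Definition span {n} (v : 'I_n -> K) : {pred K} :=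
  fun x => `[< exists c : 'I_n -> R, x = \sum_(i < n) c i *: v i >].

Lemma span_submod n (v : 'I_n -> K) : submod_closed (span v).
Proof.
split=> [|a x y /asboolP[c ->] /asboolP[d ->]].
  by apply/asboolP; exists (fun=> 0); rewrite big1// => i _; rewrite scale0r.
apply/asboolP; exists (fun i => a * c i + d i).
rewrite scaler_sumr -big_split; apply: eq_bigr => i _.
by rewrite scalerDl scalerA.
Qed.

Lemma span_lin_closed n (v : 'I_n -> K) : lin_closed [set x | x \in span v].
Proof. by have [S0 SD] := span_submod v; split. Qed.

Lemma mem_span n (v : 'I_n -> K) i : v i \in span v.
Proof.
apply/asboolP; exists (fun j => (j == i)%:R).
rewrite (bigD1 i)//= eqxx scale1r big1 ?addr0// => j /negbTE ->.
by rewrite scale0r.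
Qed.

Lemma span_complete_on n (v : 'I_n -> K) : complete_on [set x | x \in span v].
Proof.
elim: n v => [|n IHn] v.
  move=> u uS uc; exists 0; first by have [] := span_lin_closed v.
  by move=> e e0; exists 0%N => m _; have /asboolP[c ->] := uS m; rewrite big_ord0 subrr normr0.
have -> : [set x | x \in span v] = [set z | exists (a : R) s,
    [set x | x \in span (v \o lift ord0)] s /\ z = a *: v ord0 + s].
  apply/seteqP; split=> x /=.
    move=> /asboolP[c ->]; rewrite big_ord_recl.
    by eexists _, _; split; last reflexivity; apply/asboolP; exists (c \o lift ord0).
  move=> [a [s [/asboolP[c ->] ->]]].
  apply/asboolP; exists (fun i => if unlift ord0 i is Some j then c j else a).
  rewrite big_ord_recl unlift_none; congr (_ + _).
  by apply: eq_bigr => i _; rewrite liftK.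
by apply: complete_on_adjoin; [exact: span_lin_closed|exact: IHn].
Qed.

End Span.

Section SpanSpace.
Context {R : realType} {K : normedModType R} {n : nat} (v : 'I_n -> K).

HB.instance Definition _ :=
  GRing.isSubmodClosed.Build R K (span v) (span_submod v).

(** A type of its own, so that the span carries the norm of [K] and is complete
    by [span_complete_on]. *)
Record span_space := SpanSpace { span_val :> K; _ : span_val \in span v }.

HB.instance Definition _ := [isSub for span_val].
HB.instance Definition _ := [Choice of span_space by <:].
HB.instance Definition _ := [SubChoice_isSubLmodule of span_space by <:].

Let span_normD (x y : span_space) :
  `|span_val (x + y)| <= `|span_val x| + `|span_val y|.
Proof. exact: ler_normD. Qed.

Let span_normZ (a : R) (x : span_space) :
  `|span_val (a *: x)| = `|a| * `|span_val x|.
Proof. exact: normrZ. Qed.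

Let span_norm0 (x : span_space) : `|span_val x| = 0 -> x = 0.
Proof. by move=> /eqP; rewrite normr_eq0 => /eqP x0; exact: val_inj. Qed.

HB.instance Definition _ := Lmodule_isNormed.Build R span_space
  span_normD span_normZ span_norm0.

Lemma span_seq_complete : seq_complete span_space.
Proof.
move=> u uc.
have [|l lS ul] := @span_complete_on _ _ _ v (fun k => span_val (u k)) _ uc.
  by move=> k; exact: valP (u k).
by exists (SpanSpace lS).
Qed.

HB.instance Definition _ :=
  Uniform_isComplete.Build span_space (seq_complete_cvg span_seq_complete).

Lemma span_val_linear : linear span_val.
Proof. by []. Qed.

Lemma span_finite_dimensional : finite_dimensional span_space.
Proof.
exists n, (fun i => SpanSpace (mem_span v i)) => x.
have /asboolP[c xE] := valP x; exists c; apply: val_inj.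
rewrite [LHS]xE; apply: etrans (esym (lin_sum span_val_linear _ _ _)).
by apply: eq_bigr.
Qed.

End SpanSpace.

(** * Isometric embeddings and the Gurarij extension property *)

Section Embeddings.
Context {R : realType} {E F : normedModType R}.

Definition mk_emb (f : E -> F) (fP : linear_isometry f) : Emb E F :=
  exist _ (f : {ptws E -> F}) (mem_set fP).

Lemma emb_linear (f : Emb E F) : linear f.
Proof. by have [] := set_mem (valP f). Qed.

Lemma emb_norm (f : Emb E F) x : `|f x| = `|x|.
Proof. by have [_] := set_mem (valP f); exact. Qed.

Lemma emb_inj (f : Emb E F) : injective f.
Proof.
move=> x y fxy; apply/eqP; rewrite -subr_eq0 -normr_eq0 -(emb_norm f).
by rewrite (linB (emb_linear f)) fxy subrr normr0.
Qed.

Lemma embP (f g : Emb E F) : (f : E -> F) =1 g -> f = g.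
Proof. by move=> fg; apply: val_inj; apply/funext. Qed.

End Embeddings.

Section SpanInclusion.
Context {R : realType} {K L : normedModType R} {m n : nat}.
Context (v : 'I_m -> K) (w : 'I_n -> L) (f : Emb K L).
Context (fvw : forall i, f (v i) \in span w).

Lemma span_image x : x \in span v -> f x \in span w.
Proof.
move=> /asboolP[c ->]; rewrite (lin_sum (emb_linear f)).
apply: (lin_closed_sum _ _ (span_lin_closed w)) => i /=.
by rewrite (linZ (emb_linear f)); apply: (lin_closedZ _ (span_lin_closed w)); exact: fvw.
Qed.

Definition span_incl_fun (x : span_space v) : span_space w :=
  SpanSpace (span_image (valP x)).

Lemma span_incl_isometry : linear_isometry span_incl_fun.
Proof.
split=> [a x y|x]; first by apply: val_inj; exact: emb_linear.
exact: emb_norm.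
Qed.

Definition span_incl : Emb (span_space v) (span_space w) :=
  mk_emb span_incl_isometry.

End SpanInclusion.

(** The defining extension property, applied to the span of [g] inside that of
    [j g] and [k]. A subspace [S] of [K] and a map on it replace the abstract
    spaces, so that images of combinations are computed in [K] itself. *)
Lemma gurarij_extension {R : realType} (G K : completeNormedModType R)
    (gurG : gurarij G) (j : Emb G K) m r (g : 'I_m -> G) (k : 'I_r -> K)
    (e : R) : 0 < e ->
  exists (S : set K) (T : K -> G),
    [/\ lin_closed S, (forall i, S (j (g i))) /\ (forall i, S (k i)),
        forall a x y, S x -> S y -> T (a *: x + y) = a *: T x + T y,
        forall i, T (j (g i)) = g i &
        forall x, S x -> (1 - e) * `|x| <= `|T x| <= (1 + e) * `|x|].
Proof.
move=> e0; pose w (i : 'I_(m + r)) : K :=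
  match fintype.split i with inl i => j (g i) | inr i => k i end.
have wl i : w (lshift r i) = j (g i) by rewrite /w (unsplitK (inl i)).
have wr i : w (rshift m i) = k i by rewrite /w (unsplitK (inr i)).
have jgw i : j (g i) \in span w by rewrite -wl; exact: mem_span.
have kw i : k i \in span w by rewrite -wr; exact: mem_span.
have phiP : linear_isometry (@span_val _ _ _ g) by [].
have [psi [psig psin]] := gurG e e0 (span_space g) (span_space w)
  (span_finite_dimensional g) (span_finite_dimensional w)
  (span_incl jgw) (mk_emb phiP).
pose T x := if pselect (is_true (x \in span w)) is left h then psi (SpanSpace h) else 0.
have TE x (h : x \in span w) : T x = psi (SpanSpace h).
  by rewrite /T; case: pselect => // h'; rewrite (bool_irrelevance h' h).
exists [set x | x \in span w], T; split.
- exact: span_lin_closed.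
- by split.
- move=> a x y xS yS; have [_ SL] := span_lin_closed w.
  rewrite (TE _ xS) (TE _ yS) (TE _ (SL a _ _ xS yS)) -linearP.
  by congr (psi _); apply: val_inj.
- move=> i; rewrite (TE _ (jgw i)).
  rewrite -[RHS]/(mk_emb phiP (SpanSpace (mem_span g i))) -psig.
  by congr (psi _); apply: val_inj.
- by move=> x xS; rewrite (TE _ xS); exact: (psin (SpanSpace xS)).
Qed.

(** * Closeness of types of tuples and the forth step *)

Section Combinations.
Context {R : realType}.

Definition lcomb {V : lmodType R} (n : nat) (x : nat -> R) (a : nat -> V) : V :=
  \sum_(i < n) x i *: a i.

Definition weight (n : nat) (x : nat -> R) : R := \sum_(i < n) `|x i|.

Lemma weight_ge0 n x : 0 <= weight n x.
Proof. by apply: sumr_ge0. Qed.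

Lemma weightD n x y : weight n (x + y) <= weight n x + weight n y.
Proof. by rewrite /weight -big_split; apply: ler_sum => i _; exact: ler_normD. Qed.

Lemma weightZ n (c : R) x : weight n (c *: x) = `|c| * weight n x.
Proof. by rewrite /weight mulr_sumr; apply: eq_bigr => i _; exact: normrM. Qed.

Lemma lcomb_linear (V : lmodType R) n (a : nat -> V) : linear (fun x => lcomb n x a).
Proof.
move=> c x y; rewrite /lcomb scaler_sumr -big_split; apply: eq_bigr => i _.
by rewrite /= scalerA -scalerDl.
Qed.

Lemma lin_lcomb (U V : lmodType R) (f : U -> V) n x (a : nat -> U) : linear f ->
  f (lcomb n x a) = lcomb n x (f \o a).
Proof.
by move=> fl; rewrite (lin_sum fl); apply: eq_bigr => i _; rewrite (linZ fl).
Qed.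

Definition unit_coef (k i : nat) : R := (i == k)%:R.

Lemma weight_unit n k : (k < n)%N -> weight n (unit_coef k) = 1.
Proof.
move=> kn; rewrite /weight (bigD1 (Ordinal kn))//= /unit_coef eqxx normr1.
rewrite big1 ?addr0// => i; rewrite -val_eqE/= => /negbTE ->.
by rewrite normr0.
Qed.

Lemma lcomb_unit (V : lmodType R) n k (a : nat -> V) : (k < n)%N ->
  lcomb n (unit_coef k) a = a k.
Proof.
move=> kn; rewrite /lcomb (bigD1 (Ordinal kn))//= /unit_coef eqxx scale1r.
rewrite big1 ?addr0// => i; rewrite -val_eqE/= => /negbTE ->.
by rewrite scale0r.
Qed.

Lemma eq_lcomb (V : lmodType R) n x (a b : nat -> V) :
  (forall i, (i < n)%N -> a i = b i) -> lcomb n x a = lcomb n x b.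
Proof. by move=> ab; apply: eq_bigr => i _; rewrite ab. Qed.

Lemma lcomb_norm (V : normedModType R) n x (a : nat -> V) d :
  (forall i, (i < n)%N -> `|a i| <= d) -> `|lcomb n x a| <= d * weight n x.
Proof.
move=> ad; apply: (le_trans (ler_norm_sum _ _ _)).
rewrite mulr_sumr; apply: ler_sum => i _.
by rewrite normrZ mulrC ler_wpM2r// ad.
Qed.

Lemma lcombB (V : lmodType R) n x (a b : nat -> V) :
  lcomb n x a - lcomb n x b = lcomb n x (a - b).
Proof. by rewrite -sumrB; apply: eq_bigr => i _; rewrite -scalerBr. Qed.

Lemma lcomb_dist (V : normedModType R) n x (a b : nat -> V) d :
  (forall i, (i < n)%N -> `|a i - b i| <= d) ->
  `|lcomb n x a - lcomb n x b| <= d * weight n x.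
Proof. by move=> ab; rewrite lcombB; exact: lcomb_norm. Qed.

End Combinations.

Section LinearOn.
Context {R : realType} {K G : normedModType R} (S : set K) (T : K -> G).
Context (SL : lin_closed S)
  (TL : forall (a : R) x y, S x -> S y -> T (a *: x + y) = a *: T x + T y).

Lemma lin_on0 : T 0 = 0.
Proof.
have [S0 _] := SL; have := TL 1 S0 S0; rewrite !scale1r addr0.
by move=> /(congr1 (fun z => z - T 0)); rewrite subrr addrK.
Qed.

Lemma lin_onD x y : S x -> S y -> T (x + y) = T x + T y.
Proof. by move=> Sx Sy; have := TL 1 Sx Sy; rewrite !scale1r. Qed.

Lemma lin_onB x y : S x -> S y -> T (x - y) = T x - T y.
Proof. by move=> Sx Sy; rewrite addrC -scaleN1r TL// scaleN1r addrC. Qed.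

Lemma lin_on_lcomb n x (a : nat -> K) : (forall i, (i < n)%N -> S (a i)) ->
  S (lcomb n x a) /\ T (lcomb n x a) = lcomb n x (T \o a).
Proof.
move=> Sa; have [S0 SC] := SL.
apply: (big_rec2 (fun y z => S y /\ T y = z)) => [|i y z _ [Sy Ty]].
  by rewrite lin_on0.
by split; [exact: SC (Sa _ _) Sy|rewrite TL ?Ty//; exact: Sa].
Qed.

End LinearOn.

Section CloseTypes.
Context {R : realType} {E H G : normedModType R}.
Implicit Types (phi : Emb E H) (psi : Emb E G).

(** This bound on the difference of the two seminorms is equivalent to the
    distance between the types of [a] over [phi] and of [b] over [psi] being at
    most [d]. *)
Definition close_types phi psi n (a : nat -> H) (b : nat -> G) (d : R) :=
  forall e x, `| `|phi e + lcomb n x a| - `|psi e + lcomb n x b| |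
    <= d * weight n x.

End CloseTypes.

Lemma close_types_sym {R : realType} {E H G : normedModType R}
    (phi : Emb E H) (psi : Emb E G) n a b d :
  close_types phi psi n a b d -> close_types psi phi n b a d.
Proof. by move=> ab e x; rewrite distrC. Qed.

Lemma close_types_move {R : realType} {E H G : normedModType R}
    (phi : Emb E H) (psi : Emb E G) n a b b' d d' :
  (forall i, (i < n)%N -> `|b i - b' i| <= d') ->
  close_types phi psi n a b d -> close_types phi psi n a b' (d + d').
Proof.
move=> bb' ab e x; rewrite mulrDl.
rewrite -(subrKA `|psi e + lcomb n x b|) (le_trans (ler_normD _ _))// lerD//.
apply: (le_trans (ler_dist_dist _ _)); rewrite opprD addrACA subrr add0r.
exact: lcomb_dist.
Qed.

(** The coefficients of [E] have weight 0, so the two copies of [E] are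
    identified; the [k]-th unit coefficient bounds the [k]-th distance. *)
Lemma close_amalgam {R : realType} {E H G : normedModType R}
    (phi : Emb E H) (psi : Emb E G) n a b d : 0 <= d ->
  close_types phi psi n a b d ->
  exists (K : completeNormedModType R) (i : Emb H K) (j : Emb G K),
    (forall e, i (phi e) = j (psi e)) /\
    (forall k, (k < n)%N -> `|i (a k) - j (b k)| <= d).
Proof.
move=> d0 ab.
pose f (c : E * (nat -> R)) := phi c.1 + lcomb n c.2 a.
pose g (c : E * (nat -> R)) := psi c.1 + lcomb n c.2 b.
pose w (c : E * (nat -> R)) := d * weight n c.2.
have flin : linear f.
  by move=> c x y; rewrite /f emb_linear lcomb_linear scalerDr addrACA.
have glin : linear g.
  by move=> c x y; rewrite /g emb_linear lcomb_linear scalerDr addrACA.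
have ns (V : normedModType R) : seminorm (fun v : V => `|v|).
  by split; [exact: ler_normD|exact: normrZ].
have ws : seminorm w.
  split=> [x y|c x]; first by rewrite /w -mulrDr ler_wpM2l// weightD.
  by rewrite /w weightZ mulrCA.
have [K [i [j [ilin jlin inorm jnorm ij]]]] :=
  amalgamation (ns H) (ns G) ws flin glin (fun c => ab c.1 c.2).
exists K, (mk_emb (conj ilin inorm)), (mk_emb (conj jlin jnorm)); split=> [e|k kn].
  apply/eqP; rewrite -subr_eq0 -normr_le0; have := ij (e, 0).
  rewrite /f /g /w /= !(lin0 (lcomb_linear _ _)) !addr0.
  by rewrite /weight big1 ?mulr0// => l _; rewrite normr0.
have := ij (0, unit_coef k).
rewrite /f /g /w /= !(lin0 (emb_linear _)) !add0r !lcomb_unit//.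
by rewrite weight_unit// mulr1.
Qed.

(** What the back-and-forth asks of an isolated type: finitely many points of
    [E] and a distortion [eps] that already force the type up to [eta]. All
    targets [G] are allowed, so the topology of types does not appear. *)
Definition controlled {R : realType} {E H : normedModType R} (phi : Emb E H)
    n (a : nat -> H) := forall eta : R, 0 < eta ->
  exists m (e : nat -> E) (eps : R), 0 < eps /\
    forall (G : completeNormedModType R) (psi : Emb E G) (c : nat -> G),
      (forall y x, `| `|psi (lcomb m y e) + lcomb n x c|
                      - `|phi (lcomb m y e) + lcomb n x a| |
         <= eps * `|phi (lcomb m y e) + lcomb n x a|) ->
      close_types phi psi n a c eta.

(** Over the zero space a small distortion of the span of [a] is directly a
    small change of the type, by homogeneity. *)
Lemma controlled_trivial {R : realType} {E H : normedModType R} (phi : Emb E H)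
    n (a : nat -> H) : (forall e : E, e = 0) -> controlled phi n a.
Proof.
move=> E0 eta eta0; pose M := \sum_(i < n) `|a i| + 1.
have M0 : 0 < M by rewrite ltr_wpDl// sumr_ge0.
exists 0%N, (fun=> 0), (eta / M); split; first by rewrite divr_gt0.
move=> G psi c close e x; rewrite distrC.
have := close 0 x; rewrite (E0 e) (E0 (lcomb _ _ _)) => /le_trans; apply.
rewrite (lin0 (emb_linear _)) add0r -mulrA ler_wpM2l ?(ltW eta0)// ler_pdivrMl//.
apply: lcomb_norm => i iN; rewrite /M (bigD1 (Ordinal iN))//= -addrA lerDl.
by rewrite addr_ge0// sumr_ge0.
Qed.

(** The amalgam of [H] and [G] over almost matching tuples realises the new
    points of [H]; the Gurarij property copies them back into [G]. *)
Lemma forth {R : realType} {E H G : completeNormedModType R} (gurG : gurarij G)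
    (phi : Emb E H) (psi : Emb E G) n n' a b a' (d eta : R) :
  0 <= d -> 0 < eta -> close_types phi psi n a b d -> (n <= n')%N ->
  (forall i, (i < n)%N -> a' i = a i) -> controlled phi n' a' ->
  exists c, close_types phi psi n' a' c eta /\
    forall i, (i < n)%N -> `|c i - b i| <= d + eta.
Proof.
move=> d0 eta0 ab nn' aa' a'c.
have [m [e [eps [eps0 ctl]]]] := a'c eta eta0.
have [K [i [j [ij iajb]]]] := close_amalgam d0 ab.
(* The second bound keeps [(1 + eps') * d] below [d + eta]. *)
pose eps' := Num.min eps (eta / (d + 1)).
have d1 : 0 < d + 1 by rewrite ltr_wpDl.
have eps'0 : 0 < eps' by rewrite lt_min eps0 divr_gt0.
pose g (l : 'I_(m + n)) := if (l < m)%N then psi (e l) else b (l - m)%N.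
have [S [T [SL [Sg Sk] TL Tg Tn]]] :=
  gurarij_extension gurG j g (fun l : 'I_n' => i (a' l)) eps'0.
have Sa' l : (l < n')%N -> S (i (a' l)) by move=> ln; exact: (Sk (Ordinal ln)).
have gb l (ln : (l < n)%N) : g (rshift m (Ordinal ln)) = b l.
  by rewrite /g /= ltnNge leq_addr /= addKn.
have ge l (lm : (l < m)%N) : g (lshift n (Ordinal lm)) = psi (e l).
  by rewrite /g /= lm.
have Sb l : (l < n)%N -> S (j (b l)) by move=> ln; rewrite -(gb l ln).
have Tb l : (l < n)%N -> T (j (b l)) = b l by move=> ln; rewrite -(gb l ln) Tg.
have Se l : (l < m)%N -> S (i (phi (e l))) by move=> lm; rewrite ij -(ge l lm).
have Te l : (l < m)%N -> T (i (phi (e l))) = psi (e l).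
  by move=> lm; rewrite ij -(ge l lm) Tg.
have Tdist x : S x -> `| `|T x| - `|x| | <= eps' * `|x|.
  by move=> /Tn; rewrite ler_norml => /andP[h1 h2]; apply/andP; split; lra.
exists (fun l => T (i (a' l))); split.
  apply: ctl => y x; set z := phi _ + _.
  have zE : i z = lcomb m y (i \o (phi \o e)) + lcomb n' x (i \o a').
    rewrite (linD (emb_linear i)) (lin_lcomb _ _ _ (emb_linear phi)).
    by rewrite !(lin_lcomb _ _ _ (emb_linear i)).
  have [S1 T1] := lin_on_lcomb SL TL y (Se : forall l, _ -> S ((i \o (phi \o e)) l)).
  have [S2 T2] := lin_on_lcomb SL TL x (Sa' : forall l, _ -> S ((i \o a') l)).
  have Sz : S (i z) by rewrite zE; exact: lin_closedD.
  have Tz : T (i z) = psi (lcomb m y e) + lcomb n' x (T \o (i \o a')).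
    rewrite zE (lin_onD TL S1 S2) T1 T2 (lin_lcomb _ _ _ (emb_linear psi)).
    by congr (_ + _); apply: eq_lcomb => l; exact: Te.
  have := Tdist _ Sz; rewrite Tz emb_norm => /le_trans; apply.
  by rewrite ler_wpM2r// ge_min lexx.
move=> l ln; rewrite -(Tb l ln) -(lin_onB TL); last 2 first.
- by apply: Sa'; exact: leq_trans nn'.
- exact: Sb.
have Sl : S (i (a' l) - j (b l)).
  by apply: lin_closedB; [|exact: Sa' (leq_trans ln nn')|exact: Sb].
have /andP[_ /le_trans] := Tn _ Sl; apply.
rewrite mulrDl mul1r lerD//; first by rewrite aa' ?iajb.
apply: (@le_trans _ _ (eta / (d + 1) * (d + 1))); last by rewrite divfK ?gt_eqF.
apply: ler_pM => //; first exact: ltW.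
  by rewrite ge_min lexx orbT.
by rewrite aa'// (le_trans (iajb _ ln))// lerDl.
Qed.

(** * Limits of isometric correspondences *)

Section GeometricLimit.
Context {R : realType}.

Lemma geometric_small (c e : R) : 0 <= c -> 0 < e ->
  exists N, forall n, (N <= n)%N -> c / 2 ^+ n < e.
Proof.
move=> c0 e0; have c1 : 0 < c + 1 by rewrite ltr_wpDl.
have [N Ne] := natSinv_small (divr_gt0 e0 c1).
exists N => n /Ne; rewrite ltr_pdivlMr// mulrC; apply: le_lt_trans.
apply: ler_pM => //; first by rewrite lerDl.
by rewrite lef_pV2 ?posrE ?exprn_gt0// -natrX ler_nat ltn_expl.
Qed.

(** [P k] is the stage from which the point is under control; the points added
    during the construction start late. *)
Lemma geometric_limit (V : normedModType R) (Vc : seq_complete V)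
    (u : nat -> V) (P : nat -> Prop) (c : R) : 0 <= c ->
  (exists k, P k) -> (forall k, P k -> P k.+1) ->
  (forall k, P k -> `|u k.+1 - u k| <= c / 2 ^+ k) ->
  exists l, forall k, P k -> `|u k - l| <= 2 * c / 2 ^+ k.
Proof.
move=> c0 [k0 Pk0] PS uS.
have Padd k j : P k -> P (k + j)%N.
  by move=> Pk; elim: j => [|j IHj]; rewrite ?addn0// addnS; exact: PS.
have tele k j : P k -> `|u (k + j)%N - u k| <= 2 * c / 2 ^+ k - 2 * c / 2 ^+ (k + j).
  move=> Pk; elim: j => [|j IHj]; first by rewrite addn0 !subrr normr0.
  rewrite addnS -(subrKA (u (k + j)%N)) (le_trans (ler_normD _ _))//.
  have := uS _ (Padd k j Pk).
  have -> : 2 * c / 2 ^+ (k + j).+1 = c / 2 ^+ (k + j).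
    by rewrite exprS invfM mulrACA divff ?mul1r// pnatr_eq0.
  lra.
have dist k j : P k -> `|u (k + j)%N - u k| <= 2 * c / 2 ^+ k.
  move=> /(tele _ j)/le_trans; apply; rewrite gerBl.
  by rewrite divr_ge0 ?mulr_ge0 ?exprn_ge0.
have uc : cauchy_seq (fun n => u (k0 + n)%N).
  move=> e e0; have c4 : 0 <= 4 * c by rewrite mulr_ge0.
  have [N Ne] := geometric_small c4 e0; exists N => m n Nm Nn.
  apply: le_lt_trans (Ne (k0 + N)%N (leq_addl _ _)).
  rewrite -(subrKA (u (k0 + N)%N)) (le_trans (ler_normD _ _))//.
  have PN := Padd k0 N Pk0.
  have := dist _ (m - N)%N PN; have := dist _ (n - N)%N PN.
  rewrite -!addnA !subnKC// distrC => h1 h2; lra.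
have [l ul] := Vc _ uc; exists l => k Pk.
apply/ler_addgt0Pr => e e0; have [N Ne] := ul e e0.
rewrite -(subrKA (u (k + (k0 + N))%N)) (le_trans (ler_normD _ _))// lerD//.
  by rewrite distrC; exact: dist.
by rewrite addnCA ltW// Ne// (leq_trans (leq_addr k N))// addnC.
Qed.

End GeometricLimit.

Section IsometricRelation.
Context {R : realType} {V W : normedModType R} (Rel : V -> W -> Prop).
Context (RelL : forall (a : R) x y x' y', Rel x y -> Rel x' y' ->
  Rel (a *: x + x') (a *: y + y')).
Context (Reliso : forall x y, Rel x y -> `|x| = `|y|).

(** The closure of [Rel] in [V * W]. As [Rel] is linear and isometric, it is the
    graph of an isometry whose domain is closed when [W] is complete. *)
Definition rel_closure (x : V) (y : W) := forall e : R, 0 < e ->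
  exists x' y', [/\ Rel x' y', `|x - x'| < e & `|y - y'| < e].

Definition approximable (x : V) := forall e : R, 0 < e ->
  exists x' y', Rel x' y' /\ `|x - x'| < e.

Lemma rel_closure_isometric x y : rel_closure x y -> `|x| = `|y|.
Proof.
have bound (x' y' e : R) : `|x' - y'| < e -> x' <= y' + e /\ y' <= x' + e.
  by rewrite ltr_norml => /andP[? ?]; split; lra.
move=> xy; apply/eqP; rewrite -subr_eq0 -normr_le0.
apply/ler_addgt0Pr => e e0.
have [x' [y' [/Reliso xy' xx' yy']]] := xy _ (divr_gt0 e0 (ltr0Sn _ 1)).
have h1 := le_lt_trans (ler_dist_dist _ _) xx'.
have h2 := le_lt_trans (ler_dist_dist _ _) yy'.
rewrite add0r -(subrKA `|x'|) (le_trans (ler_normD _ _))// (splitr e) lerD// ?ltW//.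
by rewrite xy' distrC.
Qed.

Lemma rel_closure_linear (a : R) x y x' y' : rel_closure x y ->
  rel_closure x' y' -> rel_closure (a *: x + x') (a *: y + y').
Proof.
move=> xy xy' e e0; have a1 : 0 < `|a| + 1 by rewrite ltr_wpDl.
have e2 := divr_gt0 e0 (ltr0Sn R 1).
have [z [t [zt xz yt]]] := xy _ (divr_gt0 e2 a1).
have [z' [t' [zt' xz' yt']]] := xy' _ e2.
have aux (U : normedModType R) (p p' q q' : U) : `|p - p'| < e / 2 / (`|a| + 1) ->
    `|q - q'| < e / 2 -> `|a *: p + q - (a *: p' + q')| < e.
  rewrite ltr_pdivlMr// => h1 h2.
  rewrite opprD addrACA -scalerBr (le_lt_trans (ler_normD _ _))// normrZ.
  rewrite (splitr e) ltrD//; apply: le_lt_trans h1.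
  by rewrite mulrC ler_wpM2l// lerDl.
by exists (a *: z + z'), (a *: t + t'); split; [exact: RelL|exact: aux|exact: aux].
Qed.

Lemma rel_closure_fun x y y' : rel_closure x y -> rel_closure x y' -> y = y'.
Proof.
move=> xy xy'; have := rel_closure_linear (-1) xy xy'.
rewrite !scaleN1r addNr => /rel_closure_isometric/esym/eqP.
by rewrite normr0 normr_eq0 addrC subr_eq0 => /eqP ->.
Qed.

Lemma rel_closure_total x : seq_complete W -> approximable x ->
  exists y, rel_closure x y.
Proof.
move=> Wc xa.
have /choice[zt ztP] n : exists p : V * W, Rel p.1 p.2 /\ `|p.1 - x| < n.+1%:R^-1.
  have [|x' [y' [xy' xx']]] := xa n.+1%:R^-1; first by rewrite invr_gt0.
  by exists (x', y'); rewrite distrC.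
have zl : seq_limit (fun n => (zt n).1) x.
  by apply: near_seq_limit => n; exact: (ztP n).2.
have [|y ty] := Wc (fun n => (zt n).2).
  move=> e /(seq_limit_cauchy zl)[N Ne]; exists N => m n Nm Nn.
  apply: le_lt_trans (Ne m n Nm Nn).
  have := RelL (-1) (ztP n).1 (ztP m).1; rewrite !scaleN1r => /Reliso.
  by rewrite addrC => ->; rewrite addrC.
exists y => e e0; have [N Ne] := zl _ e0; have [M Me] := ty _ e0.
exists (zt (maxn N M)).1, (zt (maxn N M)).2; split; first exact: (ztP _).1.
  by rewrite distrC Ne// leq_maxl.
by rewrite distrC Me// leq_maxr.
Qed.

Lemma isometry_extend (X : normedModType R) (k : Emb X V) : seq_complete W ->
  (forall x, approximable (k x)) ->
  exists theta : Emb X W, forall x, rel_closure (k x) (theta x).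
Proof.
move=> Wc ka; have /choice[f fP] x : exists y, rel_closure (k x) y.
  exact: rel_closure_total.
suff fiso : linear_isometry f by exists (mk_emb fiso).
split=> [a x y|x]; last by rewrite -(rel_closure_isometric (fP x)) emb_norm.
apply: rel_closure_fun (fP _) _; rewrite emb_linear.
exact: rel_closure_linear.
Qed.

End IsometricRelation.

Section SameType.
Context {R : realType} {E H G : normedModType R}.
Context (phi : Emb E H) (psi : Emb E G) (a : nat -> H) (b : nat -> G).

Definition same_type := forall n e x,
  `|phi e + lcomb n x a| = `|psi e + lcomb n x b|.

Definition span_rel (z : H) (t : G) := exists n e x,
  z = phi e + lcomb n x a /\ t = psi e + lcomb n x b.

Lemma lcomb_widen (V : lmodType R) n m x (c : nat -> V) : (n <= m)%N ->
  lcomb n x c = lcomb m (fun i => if (i < n)%N then x i else 0) c.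
Proof.
move=> nm; rewrite /lcomb (big_ord_widen m (fun i => x i *: c i))// big_mkcond.
by apply: eq_bigr => i _; case: ifP => // _; rewrite scale0r.
Qed.

Lemma span_rel_linear (c : R) x y x' y' : span_rel x y -> span_rel x' y' ->
  span_rel (c *: x + x') (c *: y + y').
Proof.
move=> [n [e [s [-> ->]]]] [n' [e' [s' [-> ->]]]].
pose w m (t : nat -> R) i := if (i < m)%N then t i else 0.
exists (maxn n n'), (c *: e + e'), (c *: w n s + w n' s').
rewrite !emb_linear !lcomb_linear !(lcomb_widen _ _ (leq_maxl n n')).
rewrite !(lcomb_widen _ _ (leq_maxr n n')).
by split; rewrite scalerDr addrACA.
Qed.

Lemma span_rel_isometric x y : same_type -> span_rel x y -> `|x| = `|y|.
Proof. by move=> ab [n [e [s [-> ->]]]]. Qed.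

Lemma span_rel_emb e : span_rel (phi e) (psi e).
Proof.
by exists 0%N, e, (fun=> 0); rewrite /lcomb !big_ord0 !addr0.
Qed.

Lemma span_rel_coord i : span_rel (a i) (b i).
Proof.
exists i.+1, 0, (unit_coef i); rewrite !lcomb_unit//.
by rewrite (lin0 (emb_linear phi)) (lin0 (emb_linear psi)) !add0r.
Qed.

End SameType.

Lemma span_rel_sym {R : realType} {E H G : normedModType R}
    (phi : Emb E H) (psi : Emb E G) a b x y :
  span_rel phi psi a b x y -> span_rel psi phi b a y x.
Proof. by move=> [n [e [s [-> ->]]]]; exists n, e, s. Qed.

Lemma dense_range_near {R : realType} {V : normedModType R} (c : nat -> V) x
    (e : R) : dense (range c) -> 0 < e -> exists i, `|x - c i| < e.
Proof.
move=> dc e0; have [|z [/= xz [i _ cz]]] := dc (ball x e) _ (ball_open x e).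
  by exists x; exact: ballxx.
by exists i; move: xz; rewrite -cz -ball_normE.
Qed.

Lemma span_rel_dense {R : realType} {E H G : normedModType R}
    (phi : Emb E H) (psi : Emb E G) a b : dense (range a) ->
  forall x, approximable (span_rel phi psi a b) x.
Proof.
move=> da x e e0; have [i ai] := dense_range_near x da e0.
by exists (a i), (b i); split=> //; exact: span_rel_coord.
Qed.

Lemma rel_closure_self {R : realType} {V W : normedModType R}
    (Rel : V -> W -> Prop) x y : Rel x y -> rel_closure Rel x y.
Proof. by move=> xy e e0; exists x, y; rewrite !subrr !normr0. Qed.

Definition id_emb {R : realType} (V : normedModType R) : Emb V V :=
  mk_emb (conj (fun a x y => erefl) (fun x => erefl) : linear_isometry (@id V)).

(** Extending the correspondence of [a] and [b] in both directions gives two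
    maps; they are inverse to each other because both graphs lie in the same
    functional relation. *)
Lemma same_type_automorphism {R : realType} {E : normedModType R}
    {H G : completeNormedModType R}
    (phi : Emb E H) (psi : Emb E G) a b : same_type phi psi a b ->
  dense (range a) -> dense (range b) ->
  exists2 s : Emb H G, bijective s &
    (forall e, s (phi e) = psi e) /\ (forall i, s (a i) = b i).
Proof.
move=> ab da db.
have ba : same_type psi phi b a by move=> n e x; rewrite ab.
have RL := span_rel_linear (phi := phi) (psi := psi) (a := a) (b := b).
have Ri := fun x y => @span_rel_isometric _ _ _ _ phi psi a b x y ab.
have RL' := span_rel_linear (phi := psi) (psi := phi) (a := b) (b := a).
have Ri' := fun x y => @span_rel_isometric _ _ _ _ psi phi b a x y ba.
have [s sP] := isometry_extend RL Ri
  (@complete_seq_complete _ G) (k := id_emb H) (span_rel_dense phi psi b da).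
have [t tP] := isometry_extend RL' Ri'
  (@complete_seq_complete _ H) (k := id_emb G) (span_rel_dense psi phi a db).
have tK : cancel t s.
  move=> y; apply: (rel_closure_fun RL Ri (sP (t y))) => e e0.
  have [y' [x' [/span_rel_sym xy' h1 h2]]] := tP y e e0.
  by exists x', y'.
exists s.
  by exists t => // x; apply: (@emb_inj _ _ _ s); rewrite tK.
split=> [e|i]; apply: (rel_closure_fun RL Ri (sP _)); apply: rel_closure_self.
  exact: span_rel_emb.
exact: span_rel_coord.
Qed.

(** * Back-and-forth between Gurarij spaces *)

Lemma staged_choice (T : Type) (P : nat -> T -> Prop) (Q : nat -> T -> T -> Prop)
    (x0 : T) : P 0%N x0 ->
  (forall k x, P k x -> exists y, P k.+1 y /\ Q k x y) ->
  exists u : nat -> T, u 0%N = x0 /\ forall k, P k (u k) /\ Q k (u k) (u k.+1).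
Proof.
move=> P0 PS.
have /choice[F FP] (kx : nat * T) :
    exists y, P kx.1 kx.2 -> P kx.1.+1 y /\ Q kx.1 kx.2 y.
  have [/PS[y ?]|nP] := pselect (P kx.1 kx.2); first by exists y.
  by exists x0.
pose u := fix u k := if k is k'.+1 then F (k', u k') else x0.
have uP k : P k (u k) by elim: k => [//|k /(FP (k, u k))[]].
by exists u; split=> // k; split=> //; exact: (FP (k, u k) (uP k)).2.
Qed.

Lemma close_types_widen {R : realType} {E H G : normedModType R}
    (phi : Emb E H) (psi : Emb E G) n m a b d : (n <= m)%N ->
  close_types phi psi m a b d -> close_types phi psi n a b d.
Proof.
move=> nm ab e x; rewrite !(lcomb_widen _ _ nm); apply: (le_trans (ab e _)).
rewrite le_eqVlt; apply/orP; left; apply/eqP; congr (_ * _).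
rewrite /weight (big_ord_widen m (fun i => `|x i|))// [RHS]big_mkcond.
by apply: eq_bigr => i _; case: ifP => // _; rewrite normr0.
Qed.

Lemma close_types_le {R : realType} {E H G : normedModType R}
    (phi : Emb E H) (psi : Emb E G) n a b d d' : d <= d' ->
  close_types phi psi n a b d -> close_types phi psi n a b d'.
Proof.
by move=> dd' ab e x; apply: (le_trans (ab e x)); rewrite ler_wpM2r// weight_ge0.
Qed.

Section Limits.
Context {R : realType} {E : normedModType R} {H G : normedModType R}.
Context (Hc : seq_complete H) (Gc : seq_complete G).
Context (phi : Emb E H) (psi : Emb E G).

Lemma close_types_geometric n a b (c : R) K : 0 <= c ->
  (forall k, (K <= k)%N -> close_types phi psi n a b (c / 2 ^+ k)) ->
  forall e x, `|phi e + lcomb n x a| = `|psi e + lcomb n x b|.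
Proof.
move=> c0 ab e x; apply/eqP; rewrite -subr_eq0 -normr_le0.
apply/ler_addgt0Pr => d d0; rewrite add0r.
have [N Ne] := geometric_small (mulr_ge0 c0 (weight_ge0 n x)) d0.
apply: (le_trans (ab (maxn K N) (leq_maxl _ _) e x)).
by rewrite mulrAC ltW// Ne// leq_maxr.
Qed.

(** The errors [c / 2 ^+ k] vanish and the moves [d / 2 ^+ k] are summable, so
    the limits of the two tuples have exactly the same type. *)
Lemma back_and_forth_limit (N : nat -> nat) (a : nat -> nat -> H)
    (b : nat -> nat -> G) (c d : R) : 0 <= c -> 0 <= d ->
  (forall k, (k <= N k)%N /\ (N k <= N k.+1)%N) ->
  (forall k, close_types phi psi (N k) (a k) (b k) (c / 2 ^+ k)) ->
  (forall k i, (i < N k)%N -> `|a k.+1 i - a k i| <= d / 2 ^+ k) ->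
  (forall k i, (i < N k)%N -> `|b k.+1 i - b k i| <= d / 2 ^+ k) ->
  exists a' b', [/\ same_type phi psi a' b',
    forall k i, (i < N k)%N -> `|a k i - a' i| <= 2 * d / 2 ^+ k &
    forall k i, (i < N k)%N -> `|b k i - b' i| <= 2 * d / 2 ^+ k].
Proof.
move=> c0 d0 NP ab aS bS.
have lim (V : normedModType R) (u : nat -> nat -> V) : seq_complete V ->
    (forall k i, (i < N k)%N -> `|u k.+1 i - u k i| <= d / 2 ^+ k) ->
    exists u', forall k i, (i < N k)%N -> `|u k i - u' i| <= 2 * d / 2 ^+ k.
  move=> Vc uS.
  have /choice[u' u'P] i : exists l, forall k, (i < N k)%N -> `|u k i - l| <= 2 * d / 2 ^+ k.
    apply: (geometric_limit Vc) => // [|k iN|k]; last exact: uS.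
      by exists i.+1; exact: (NP i.+1).1.
    exact: leq_trans iN (NP k).2.
  by exists u' => k i; exact: u'P.
have [a' a'P] := lim _ _ Hc aS; have [b' b'P] := lim _ _ Gc bS.
exists a', b'; split=> // n; apply: (@close_types_geometric _ _ _ (c + 2 * d + 2 * d) n).
  by rewrite !addr_ge0// mulr_ge0.
move=> k nk; have nN : (n <= N k)%N by apply: leq_trans nk (NP k).1.
rewrite (mulrDl (_ + _)) (mulrDl c); apply: (close_types_move (b := b k)) => [i iN|].
  by apply: b'P; exact: leq_trans nN.
apply: close_types_sym; apply: (close_types_move (b := a k)) => [i iN|].
  by apply: a'P; exact: leq_trans nN.
by apply: close_types_sym; exact: close_types_widen nN (ab k).
Qed.

End Limits.

(** The exponent of 2 in [k + 1] takes each value infinitely often, so every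
    point of a dense sequence is approximated at arbitrarily late stages. *)
Definition recurrent_index (k : nat) : nat := logn 2 k.+1.

Lemma recurrent_indexP m K : exists2 k, (K <= k)%N & recurrent_index k = m.
Proof.
exists (2 ^ m * K.*2.+1).-1.
  rewrite -ltnS prednK ?muln_gt0 ?expn_gt0//.
  by rewrite (leq_trans _ (leq_pmull _ _)) ?expn_gt0// ltnS -addnn leq_addr.
rewrite /recurrent_index prednK ?muln_gt0 ?expn_gt0//.
rewrite lognM ?expn_gt0// pfactorK// logn_coprime ?addn0//.
by rewrite coprime2n /= odd_double.
Qed.

Definition extend {T : Type} n (a : nat -> T) (x : T) : nat -> T :=
  fun i => if (i < n)%N then a i else x.

Definition tuple_in {V : Type} (d : nat -> V) n (a : nat -> V) :=
  forall i, (i < n)%N -> range d (a i).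

Lemma dense_tuple_near {R : realType} {V : normedModType R} (d : nat -> V)
    (c : nat -> V) (e : R) : dense (range d) -> 0 < e ->
  exists b, (forall n, tuple_in d n b) /\ forall i, `|c i - b i| <= e.
Proof.
move=> dd e0; have /choice[f fP] i : exists m, `|c i - d m| < e.
  exact: dense_range_near.
by exists (d \o f); split=> [n i _|i]; [exists (f i)|exact: ltW].
Qed.

(** The copies supplied by [forth] are pushed back into the dense sequence, since
    only tuples from there are known to be controlled; half of the target
    error [d / 2] is spent on each of the two moves. *)
Lemma forth_dense {R : realType} {E H G : completeNormedModType R}
    (gurG : gurarij G) (phi : Emb E H) (psi : Emb E G) (dH : nat -> H)
    (dG : nat -> G) n a b m (d : R) : dense (range dG) -> 0 < d ->
  (forall n a, tuple_in dH n a -> controlled phi n a) ->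
  tuple_in dH n a -> close_types phi psi n a b d ->
  exists b', [/\ tuple_in dG n.+1 b', tuple_in dH n.+1 (extend n a (dH m)),
    close_types phi psi n.+1 (extend n a (dH m)) b' (d / 2) &
    forall i, (i < n)%N -> `|b' i - b i| <= 2 * d].
Proof.
move=> ddG d0 ctl aH ab; have d4 : 0 < d / 4 by rewrite divr_gt0.
have a'H : tuple_in dH n.+1 (extend n a (dH m)).
  by rewrite /extend => i _; case: ifP => [/aH//|_]; exists m.
have [//|c [ac cb]] := forth gurG (ltW d0) d4 ab (leqnSn n) _ (ctl _ _ a'H).
  by move=> i iN; rewrite /extend iN.
have [b' [b'G cb']] := dense_tuple_near c ddG d4.
exists b'; split=> // [|i iN].
  have -> : d / 2 = d / 4 + d / 4 by lra.
  by apply: close_types_move ac => i _; exact: cb'.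
rewrite -(subrKA (c i)) (le_trans (ler_normD _ _))//.
have := cb i iN; have := cb' i; rewrite distrC; lra.
Qed.

Section BackAndForth.
Context {R : realType} {E H G : completeNormedModType R}.
Context (gurH : gurarij H) (gurG : gurarij G).
Context (phi : Emb E H) (psi : Emb E G) (dH : nat -> H) (dG : nat -> G).
Context (ddH : dense (range dH)) (ddG : dense (range dG)).
Context (ctlH : forall n a, tuple_in dH n a -> controlled phi n a).
Context (ctlG : forall n b, tuple_in dG n b -> controlled psi n b).

Lemma back_and_forth_step n a b h g (d : R) : 0 < d ->
  tuple_in dH n a -> tuple_in dG n b -> close_types phi psi n a b d ->
  exists a' b', [/\ tuple_in dH n.+2 a', tuple_in dG n.+2 b',
    close_types phi psi n.+2 a' b' (d / 2),
    (forall i, (i < n)%N -> `|a' i - a i| <= 2 * d) /\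
    (forall i, (i < n)%N -> `|b' i - b i| <= 2 * d) &
    `|a' n - dH h| <= 2 * d /\ b' n.+1 = dG g].
Proof.
move=> d0 aH bG ab.
have [b1 [b1G a1H ab1 bb1]] := forth_dense gurG h ddG d0 ctlH aH ab.
have d2 : 0 < d / 2 by rewrite divr_gt0.
have [a2 [a2H b2G ba2 aa2]] := forth_dense gurH g ddH d2 ctlG b1G (close_types_sym ab1).
have dd : 2 * (d / 2) <= 2 * d by lra.
exists a2, (extend n.+1 b1 (dG g)); split=> //.
- by apply: close_types_le (close_types_sym ba2); lra.
- split=> i iN; last by rewrite /extend ltnS ltnW//; exact: bb1.
  have := aa2 i (ltnW iN); rewrite /extend iN => /le_trans; exact.
- split; last by rewrite /extend ltnn.
  by have := aa2 n (ltnSn n); rewrite /extend ltnn => /le_trans; exact.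
Qed.

(** Each tuple moves by at most [2 * d / 2 ^+ k] at stage [k], in total [4 * d]
    on either side. *)
Lemma back_and_forth_in n a b (d : R) : 0 < d ->
  tuple_in dH n a -> tuple_in dG n b -> close_types phi psi n a b d ->
  exists2 s : Emb H G, bijective s & (forall e, s (phi e) = psi e) /\
    forall i, (i < n)%N -> `|s (a i) - b i| <= 8 * d.
Proof.
move=> d0 aH bG ab; pose dk k := d / 2 ^+ k.
have dk0 k : 0 < dk k by rewrite divr_gt0// exprn_gt0.
have dkS k : dk k / 2 = dk k.+1 by rewrite /dk exprS invfM mulrCA mulrC.
pose P k (p : (nat -> H) * (nat -> G)) := [/\ tuple_in dH (n + k.*2) p.1,
  tuple_in dG (n + k.*2) p.2 & close_types phi psi (n + k.*2) p.1 p.2 (dk k)].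
pose Q k (p q : (nat -> H) * (nat -> G)) :=
  ((forall i, (i < n + k.*2)%N -> `|q.1 i - p.1 i| <= 2 * dk k) /\
   (forall i, (i < n + k.*2)%N -> `|q.2 i - p.2 i| <= 2 * dk k)) /\
  (`|q.1 (n + k.*2)%N - dH (recurrent_index k)| <= 2 * dk k /\
   q.2 (n + k.*2).+1 = dG (recurrent_index k)).
have [||u [u0 uP]] := @staged_choice _ P Q (a, b).
- by rewrite /P double0 addn0 /dk expr0 divr1.
- move=> k [a1 b1] [/= a1H b1G ab1].
  have [a2 [b2 [a2H b2G ab2 mv nw]]] := back_and_forth_step
    (recurrent_index k) (recurrent_index k) (dk0 k) a1H b1G ab1.
  by exists (a2, b2); split=> //; rewrite /P doubleS !addnS -dkS.
pose N k := (n + k.*2)%N.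
have [||||||a' [b' [ab' a'P b'P]]] := @back_and_forth_limit R E H G
  (@complete_seq_complete _ H) (@complete_seq_complete _ G) phi psi N
  (fun k => (u k).1) (fun k => (u k).2) d (2 * d).
- exact: ltW.
- by rewrite mulr_ge0// ltW.
- move=> k; rewrite /N doubleS !addnS; split; last by rewrite ltnW.
  by rewrite (leq_trans _ (leq_addl _ _))// -addnn leq_addr.
- by move=> k; have [[]] := uP k.
- by move=> k i iN; have [_ [[+ _] _]] := uP k; rewrite -mulrA; apply.
- by move=> k i iN; have [_ [[_ +] _]] := uP k; rewrite -mulrA; apply.
have dense_lim (V : normedModType R) (v : nat -> V) (w : nat -> V) (f : nat -> nat) :
    dense (range v) -> (forall k, `|v (recurrent_index k) - w (f k)| <= 6 * d / 2 ^+ k) ->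
    dense (range w).
  move=> dv vw O [x Ox] oO.
  have /nbhs_ballP[e /= e0 eO] : nbhs x O by exact: open_nbhs_nbhs.
  have e2 := divr_gt0 e0 (ltr0Sn R 1).
  have [m xm] := dense_range_near x dv e2.
  have d6 : 0 <= 6 * d by rewrite mulr_ge0// ltW.
  have [K Ke] := geometric_small d6 e2.
  have [k Kk km] := recurrent_indexP m K.
  exists (w (f k)); split; last by exists (f k).
  apply: eO; rewrite -ball_normE /= -(subrKA (v m)) (splitr e).
  rewrite (le_lt_trans (ler_normD _ _))// ltrD// -km.
  exact: le_lt_trans (vw k) (Ke k Kk).
have Nlt k : (N k < N k.+1)%N /\ ((N k).+1 < N k.+1)%N.
  by rewrite /N doubleS !addnS; split.
(* A point added at stage [k] is under control from stage [k + 1] on. *)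
have half k : 2 * (2 * d) / 2 ^+ k.+1 = 2 * dk k.
  by rewrite /dk exprS invfM; field; rewrite expf_neq0.
have [s sbij [sphi sa]] : exists2 s : Emb H G, bijective s &
    (forall e, s (phi e) = psi e) /\ (forall i, s (a' i) = b' i).
  apply: (same_type_automorphism ab').
    apply: (dense_lim _ dH _ N ddH) => k; rewrite -mulrA -/(dk k).
    have [_ [_ [h _]]] := uP k; have := a'P k.+1 _ (Nlt k).1; rewrite half => h'.
    rewrite -(subrKA ((u k.+1).1 (N k))) (le_trans (ler_normD _ _))// distrC.
    have := dk0 k; move: h h'; rewrite -/(N k); lra.
  apply: (dense_lim _ dG _ (fun k => (N k).+1) ddG) => k; rewrite -mulrA -/(dk k).
  have [_ [_ [_ <-]]] := uP k; have := b'P k.+1 _ (Nlt k).2; rewrite half.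
  have := dk0 k; rewrite -/(N k); lra.
exists s => //; split=> // i iN.
have := a'P 0%N i; have := b'P 0%N i; rewrite u0 /N addn0 expr0 !divr1 => /(_ iN) hb /(_ iN) ha.
rewrite -(subrKA (s (a' i))) (le_trans (ler_normD _ _))//.
rewrite -(linB (emb_linear s)) emb_norm sa [X in _ + X]distrC.
move: ha hb => /=; lra.
Qed.

(** Moving both tuples into the dense sequences costs [d] each and worsens the
    closeness to [3 * d], whence [8 * 3 + 2]. *)
Lemma back_and_forth n a b (d : R) : 0 < d -> close_types phi psi n a b d ->
  exists2 s : Emb H G, bijective s & (forall e, s (phi e) = psi e) /\
    forall i, (i < n)%N -> `|s (a i) - b i| <= 26 * d.
Proof.
move=> d0 ab; have [a' [a'H aa']] := dense_tuple_near a ddH d0.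
have [b' [b'G bb']] := dense_tuple_near b ddG d0.
have ab' : close_types phi psi n a' b' (d + d + d).
  apply: (close_types_move (b := b)) => [i _|]; first exact: bb'.
  apply: close_types_sym; apply: (close_types_move (b := a)) => [i _|]; first exact: aa'.
  exact: close_types_sym.
have [|s sbij [sphi sab]] := back_and_forth_in _ (a'H n) (b'G n) ab'; first lra.
exists s => //; split=> // i iN.
rewrite -(subrKA (s (a' i))) (le_trans (ler_normD _ _))//.
rewrite -(linB (emb_linear s)) emb_norm -(subrKA (b' i)).
have := ler_normD (s (a' i) - b' i) (b' i - b i); rewrite [`|b' i - _|]distrC.
have := aa' i; have := bb' i; have := sab i iN; lra.
Qed.

End BackAndForth.

(** * Separable extensions inside a Gurarij space *)

Section ZeroSpace.
Context {R : realType} (V : normedModType R).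

Definition zero_space : completeNormedModType R :=
  span_space (fun _ : 'I_0 => 0 : V).

Lemma zero_spaceE (z : zero_space) : z = 0.
Proof. by apply: val_inj; have /asboolP[c ->] := valP z; rewrite big_ord0. Qed.

Lemma zero_emb_isometry (W : normedModType R) :
  linear_isometry (fun _ : zero_space => 0 : W).
Proof.
split=> [a x y|x]; first by rewrite scaler0 addr0.
by rewrite (zero_spaceE x) !normr0.
Qed.

Definition zero_emb (W : normedModType R) : Emb zero_space W :=
  mk_emb (zero_emb_isometry W).

Lemma zero_embE (W : normedModType R) z : zero_emb W z = 0.
Proof. by []. Qed.

End ZeroSpace.

Section Realization.
Context {R : realType} {K G : completeNormedModType R} (gurG : gurarij G).

Let phi := zero_emb G K.
Let psi := zero_emb G G.

(** Only one direction of the back-and-forth is run: [d] stays fixed, every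
    tuple over the zero space is controlled, and the approximations in [G]
    converge. *)
Lemma gurarij_sequence (d : nat -> K) n (b : nat -> G) (del : R) : 0 < del ->
  close_types phi psi n d b del ->
  exists b', same_type phi psi d b' /\
    forall i, (i < n)%N -> `|b i - b' i| <= 4 * del.
Proof.
move=> del0 db; pose dk k := del / 2 ^+ k.
have dk0 k : 0 < dk k by rewrite divr_gt0// exprn_gt0.
pose P k (p : nat -> G) := close_types phi psi (n + k) d p (dk k).
pose Q k (p q : nat -> G) := forall i, (i < n + k)%N -> `|q i - p i| <= 2 * dk k.
have [||u [u0 uP]] := @staged_choice _ P Q b.
- by rewrite /P addn0 /dk expr0 divr1.
- move=> k p Pp.
  have [//|c [dc cp]] := forth gurG (ltW (dk0 k)) (dk0 k.+1) Pp (leqnSn _) _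
    (controlled_trivial phi _ d (@zero_spaceE _ _)).
  exists c; split; first by rewrite /P addnS.
  move=> i iN; apply: (le_trans (cp i iN)).
  have : dk k.+1 = dk k / 2 by rewrite /dk exprS invfM mulrCA mulrC.
  have := dk0 k; lra.
have [||||||d' [b' [d'b' dd' bb']]] := @back_and_forth_limit R _ K G
  (@complete_seq_complete _ K) (@complete_seq_complete _ G) phi psi
  (fun k => (n + k)%N) (fun=> d) u del (2 * del).
- exact: ltW.
- by rewrite mulr_ge0// ltW.
- by move=> k; rewrite leq_addl addnS leqnSn.
- by move=> k; have [] := uP k.
- by move=> k i _; rewrite subrr normr0 divr_ge0 ?exprn_ge0// mulr_ge0// ltW.
- by move=> k i iN; rewrite -mulrA; have [_ ] := uP k; apply.
exists b'; split=> [m e x|i iN].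
  rewrite -d'b'; congr (`|_ + _|); apply: eq_lcomb => i _.
  apply/eqP; rewrite -subr_eq0 -normr_le0; apply/ler_addgt0Pr => eps eps0.
  have [N Ne] := geometric_small (ltW (mulr_gt0 (ltr0Sn R 3) del0)) eps0.
  have iN : (i < n + (i.+1 + N))%N by rewrite addnA ltn_addr// ltn_addl.
  rewrite add0r; apply: (le_trans (dd' _ _ iN)); rewrite ltW//.
  have -> : 2 * (2 * del) = 4 * del by lra.
  by rewrite Ne// leq_addl.
have := bb' 0%N i; rewrite addn0 u0 expr0 divr1 => /(_ iN).
by have -> : 2 * (2 * del) = 4 * del by lra.
Qed.

End Realization.

(** The sequence to copy lists [e], then [c], then a dense part of [E]: its first
    [m + n] terms carry the prescribed approximation, and its closed span
    contains [E] and [c]. *)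
Lemma gurarij_universal {R : realType} {E K G : completeNormedModType R}
    (gurG : gurarij G) (dE : nat -> E) (j : Emb E K) (psi0 : Emb E G)
    m (e : nat -> E) n (c : nat -> K) (b : nat -> G) (del : R) :
  dense (range dE) -> 0 < del ->
  (forall y x, `| `|j (lcomb m y e) + lcomb n x c|
                 - `|psi0 (lcomb m y e) + lcomb n x b| |
     <= del * (weight m y + weight n x)) ->
  exists (psi : Emb E G) (c' : nat -> G),
    [/\ forall v x, `|j v + lcomb n x c| = `|psi v + lcomb n x c'|,
        forall i, (i < m)%N -> `|psi (e i) - psi0 (e i)| <= 4 * del &
        forall i, (i < n)%N -> `|c' i - b i| <= 4 * del].
Proof.
move=> ddE del0 close.
pose d i := if (i < m)%N then j (e i) else
  if (i < m + n)%N then c (i - m)%N else j (dE (i - (m + n))%N).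
pose b0 i := if (i < m)%N then psi0 (e i) else b (i - m)%N.
have dl i : (i < m)%N -> d i = j (e i) by rewrite /d => ->.
have dr i : (i < n)%N -> d (m + i)%N = c i.
  by move=> iN; rewrite /d ltnNge leq_addr ltn_add2l iN addKn.
have bl i : (i < m)%N -> b0 i = psi0 (e i) by rewrite /b0 => ->.
have br i : b0 (m + i)%N = b i by rewrite /b0 ltnNge leq_addr addKn.
have split_lcomb (V : normedModType R) x (a : nat -> V) :
    lcomb (m + n) x a = lcomb m x a + lcomb n (x \o addn m) (a \o addn m).
  by rewrite /lcomb big_split_ord.
have [|b' [db' bb']] := gurarij_sequence gurG (d := d) (b := b0) del0 (n := m + n).
  move=> v x; rewrite !zero_embE !add0r !split_lcomb.
  have -> : weight (m + n) x = weight m x + weight n (x \o addn m).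
    by rewrite /weight big_split_ord.
  rewrite (eq_lcomb x dl) (eq_lcomb x bl) -(lin_lcomb _ _ _ (emb_linear j)).
  rewrite -(lin_lcomb _ _ _ (emb_linear psi0)).
  rewrite (eq_lcomb (b := c) _ dr) (@eq_lcomb _ _ n _ (b0 \o addn m) b).
    by apply: close.
  by move=> i _; exact: br.
pose Rel := span_rel (zero_emb G K) (zero_emb G G) d b'.
have RL : forall (a : R) x y x' y', Rel x y -> Rel x' y' -> Rel (a *: x + x') (a *: y + y').
  exact: span_rel_linear.
have Ri x y : Rel x y -> `|x| = `|y| by exact: span_rel_isometric.
have jappr v : approximable Rel (j v).
  move=> eps eps0; have [k vk] := dense_range_near v ddE eps0.
  exists (d (m + n + k)%N), (b' (m + n + k)%N); split; first exact: span_rel_coord.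
  rewrite /d -addnA ltnNge leq_addr /= addnA ltnNge leq_addr /= addKn.
  by rewrite -(linB (emb_linear j)) emb_norm.
have [psi psiP] := isometry_extend RL Ri (@complete_seq_complete _ G) jappr.
have relc x : rel_closure Rel (lcomb n x c) (lcomb n x (b' \o addn m)).
  rewrite -(eq_lcomb (a := d \o addn m) _ dr).
  apply: (big_rec2 (rel_closure Rel)) => [|i y1 y2 _ h].
    by apply: rel_closure_self; exists 0%N, 0, (fun=> 0); rewrite /lcomb !big_ord0 !addr0.
  by apply: (rel_closure_linear RL) h; apply: rel_closure_self; exact: span_rel_coord.
exists psi, (b' \o addn m); split=> [v x|i im|i iN] /=.
- apply: (rel_closure_isometric Ri).
  have := rel_closure_linear RL 1 (psiP v) (relc x).
  by rewrite !scale1r.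
- have -> : psi (e i) = b' i.
    apply: (rel_closure_fun RL Ri (psiP _)); rewrite -dl//.
    by apply: rel_closure_self; exact: span_rel_coord.
  by rewrite -bl// distrC; apply: bb'; exact: ltn_addr.
- by rewrite -br distrC; apply: bb'; rewrite ltn_add2l.
Qed.

(** * Pointwise topologies and the distance between types *)

Section PointwiseSubspace.
Context {R : realType} {U : topologicalType} {V : pseudoMetricType R}.
Context (S : set {ptws U -> V}).

(** The sets on the right form a filter that converges pointwise to [x], hence
    in the topology. *)
Lemma ptws_sub_nbhsP (x : set_type S) (A : set (set_type S)) :
  nbhs x A <-> exists s : seq U, exists2 e : R, 0 < e &
    forall y : set_type S,
      (forall u, u \in s -> ball (\val x u : V) e (\val y u)) -> A y.
Proof.
pose F : set_system (set_type S) := fun A => exists s : seq U, exists2 e : R, 0 < e &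
    forall y : set_type S,
      (forall u, u \in s -> ball (\val x u : V) e (\val y u)) -> A y.
have FF : Filter F.
  split; first by exists [::], 1.
  - move=> B C [s [e e0 B_]] [t [d d0 C_]]; exists (s ++ t), (Num.min e d).
      by rewrite lt_min e0.
    move=> y near; split.
      apply: B_ => u us; apply: le_ball (near u _); first by rewrite ge_min lexx.
      by rewrite mem_cat us.
    apply: C_ => u ut; apply: le_ball (near u _); first by rewrite ge_min lexx orbT.
    by rewrite mem_cat ut orbT.
  - by move=> B C BC [s [e e0 B_]]; exists s, e => // y /B_ /BC.
split=> [|[s [e e0 sA]]].
  suff cvgF : (\val : set_type S -> {ptws U -> V}) @ F --> (\val x : {ptws U -> V}).
    rewrite nbhsE => -[_ [[C oC <-] Cx] CA].
    have : F (\val @^-1` C) by apply: cvgF; exact: open_nbhs_nbhs.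
    exact: filterS.
  apply/pointwise_cvgP => t; apply/cvg_ballP => e e0.
  by exists [:: t], e => // y; apply; rewrite mem_seq1.
have cval u : continuous (fun y : set_type S => \val y u : V).
  move=> y; have : (\val : set_type S -> {ptws U -> V}) @ y --> (\val y : {ptws U -> V}).
    exact: (@initial_continuous S {ptws U -> V} set_val y).
  move/pointwise_cvgP => h; apply: (h _ u).
  by apply: fmap_filter; exact: (@nbhs_filter (set_type S) y).
suff : nbhs x [set y | forall u, u \in s -> ball (\val x u : V) e (\val y u)].
  by apply: filterS => y; exact: sA.
elim: s {sA} => [|u s IHs]; first by apply: filterS filterT => y _ u; rewrite in_nil.
have /cvg_ballP/(_ e e0) := cval u x.
apply: filterS2 IHs => y ys yu v; rewrite in_cons => /predU1P[-> //|]; exact: ys.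
Qed.

End PointwiseSubspace.

Lemma emb_nbhsP {R : realType} {E F : normedModType R} (f : Emb E F)
    (A : set (Emb E F)) :
  nbhs f A <-> exists s : seq E, exists2 e : R, 0 < e &
    forall g : Emb E F, (forall u, u \in s -> `|f u - g u| < e) -> A g.
Proof.
split=> [/ptws_sub_nbhsP[s [e e0 sA]]|[s [e e0 sA]]].
  exists s, e => // g fg; apply: sA => u us; rewrite -ball_normE; exact: fg.
apply/ptws_sub_nbhsP; exists s, e => // g fg; apply: sA => u us.
by have := fg u us; rewrite -ball_normE.
Qed.

Lemma aut_nbhsP {R : realType} {G : normedModType R} (f : Aut G)
    (A : set (Aut G)) :
  nbhs f A <-> exists s : seq G, exists2 e : R, 0 < e &
    forall g : Aut G, (forall u, u \in s -> `|f u - g u| < e) -> A g.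
Proof.
split=> [/ptws_sub_nbhsP[s [e e0 sA]]|[s [e e0 sA]]].
  exists s, e => // g fg; apply: sA => u us; rewrite -ball_normE; exact: fg.
apply/ptws_sub_nbhsP; exists s, e => // g fg; apply: sA => u us.
by have := fg u us; rewrite -ball_normE.
Qed.

Section Types.
Context {R : realType} {E : completeNormedModType R} {n : nat}.
Implicit Types (xi zeta : ntype E n) (z : E * 'rV[R]_n).

Definition type_norm xi : E * 'rV[R]_n -> R := \val xi.

Lemma type_normP xi : seminorm (type_norm xi) /\ forall b, type_norm xi (b, 0) = `|b|.
Proof. exact: set_mem (valP xi). Qed.

Lemma ntypeP xi zeta : type_norm xi =1 type_norm zeta -> xi = zeta.
Proof. by move=> h; apply: val_inj; apply/funext. Qed.

Lemma ntype_nbhsP xi (A : set (ntype E n)) :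
  nbhs xi A <-> exists s : seq (E * 'rV[R]_n), exists2 e : R, 0 < e &
    forall zeta, (forall z, z \in s -> `|type_norm xi z - type_norm zeta z| < e) -> A zeta.
Proof. exact: ptws_sub_nbhsP. Qed.

Definition row_weight (x : 'rV[R]_n) : R := \sum_(i < n) `|x 0 i|.

(** By homogeneity, the difference of the two seminorms is at most [d] on every
    formal vector whose coefficients have weight 1. *)
Definition type_close xi zeta (d : R) :=
  forall z, `|type_norm xi z - type_norm zeta z| <= d * row_weight z.2.

Lemma row_weight_seminorm : seminorm row_weight.
Proof.
split=> [x y|a x]; rewrite /row_weight.
  by rewrite -big_split; apply: ler_sum => i _; rewrite mxE; exact: ler_normD.
by rewrite mulr_sumr; apply: eq_bigr => i _; rewrite mxE normrM.
Qed.

Lemma row_weight_ge0 x : 0 <= row_weight x.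
Proof. exact: seminorm_ge0 row_weight_seminorm x. Qed.

Lemma type_close_sym xi zeta d : type_close xi zeta d -> type_close zeta xi d.
Proof. by move=> h z; rewrite distrC. Qed.

Lemma type_close_trans xi zeta theta d d' :
  type_close xi zeta d -> type_close zeta theta d' -> type_close xi theta (d + d').
Proof.
move=> h h' z; rewrite -(subrKA (type_norm zeta z)) (le_trans (ler_normD _ _))//.
by rewrite mulrDl lerD// ?h ?h'.
Qed.

Section OneEmbedding.
Context {K : normedModType R} (i : E * 'rV[R]_n -> K)
  (xi : ntype E n) (ilin : linear i) (inorm : forall z, `|i z| = type_norm xi z).

Lemma type_emb_isometry : linear_isometry (fun e : E => i (e, 0)).
Proof.
split=> [a x y|x]; last by rewrite inorm (type_normP xi).2.
by rewrite -ilin; congr i; apply/pair_equal_spec; rewrite /= scaler0 addr0.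
Qed.

Lemma realized_type (j : Emb E K) : (forall e, j e = i (e, 0)) ->
  tp j (fun k => i (0, 'e_k)) = xi.
Proof.
move=> jE; apply: ntypeP => -[e x]; rewrite -inorm.
rewrite -[LHS]/(`|j e + \sum_(k < n) x 0 k *: i (0, 'e_k)|) jE.
have -> : \sum_(k < n) x 0 k *: i (0, 'e_k) = i (\sum_(k < n) x 0 k *: (0 : E, 'e_k)).
  by rewrite (lin_sum ilin); apply: eq_bigr => k _; rewrite (linZ ilin).
rewrite -(linD ilin); congr (`|i _|).
have -> : \sum_(k < n) x 0 k *: (0 : E, 'e_k) = (0, x).
  rewrite {2}[x]row_sum_delta; elim/big_rec2: _ => // k y z _ ->.
  by apply/pair_equal_spec; rewrite /= scaler0 addr0.
by apply/pair_equal_spec; rewrite /= addr0 add0r.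
Qed.

End OneEmbedding.

(** Two types whose seminorms are close have an amalgam over [E] in which the
    realisations are close. With the triangle inequality, which gives
    [type_dist_close], the distance between types becomes the uniform distance
    between their seminorms. *)
Lemma type_dist_le xi zeta d : 0 <= d -> type_close xi zeta d ->
  (type_dist xi zeta <= d%:E)%E.
Proof.
move=> d0 close.
have idlin : linear (@id (E * 'rV[R]_n)) by [].
have ws : seminorm (fun z : E * 'rV[R]_n => d * row_weight z.2).
  have [wD wZ] := row_weight_seminorm.
  split=> [x y|a x]; first by rewrite -mulrDr ler_wpM2l//; exact: wD.
  by rewrite [row_weight _]wZ mulrCA.
have [K [i [j [ilin jlin inorm jnorm ij]]]] :=
  amalgamation (type_normP xi).1 (type_normP zeta).1 ws idlin idlin close.
pose k := mk_emb (type_emb_isometry ilin inorm).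
have kj e : k e = j (e, 0).
  apply/eqP; rewrite -subr_eq0 -normr_le0; apply: (le_trans (ij (e, 0))).
  by rewrite /row_weight big1 ?mulr0// => l _; rewrite /= mxE normr0.
pose a l := i (0, 'e_l); pose b l := j (0, 'e_l).
apply: (@le_trans _ _ (tuple_dist a b)%:E).
  apply: ereal_inf_lbound; exists K, k, a, b; split=> //.
    exact: (realized_type ilin inorm).
  exact: (realized_type jlin jnorm).
rewrite lee_fin; apply: (@big_ind R (fun r => r <= d)) => //.
  by move=> r r' rd r'd; rewrite ge_max rd.
move=> l _; apply: (le_trans (ij (0, 'e_l))).
rewrite /row_weight /= (bigD1 l)//= mxE !eqxx normr1 big1 ?addr0 ?mulr1// => m ml.
by rewrite mxE (negbTE ml) andbF normr0.
Qed.

Lemma type_dist_close xi zeta d : (type_dist xi zeta < d%:E)%E ->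
  type_close xi zeta d.
Proof.
move=> /ereal_inf_lt[_ [K [j [a [b [<- <- ->]]]]]]; rewrite lte_fin => ltd [e x].
rewrite -[type_norm _ _]/(`|j e + \sum_(k < n) x 0 k *: a k|).
rewrite -[type_norm (tp j b) _]/(`|j e + \sum_(k < n) x 0 k *: b k|).
apply: (le_trans (ler_dist_dist _ _)); rewrite opprD addrACA subrr add0r -sumrB.
apply: (le_trans (ler_norm_sum _ _ _)); rewrite mulr_sumr; apply: ler_sum => k _.
rewrite -scalerBr normrZ mulrC ler_wpM2r//; apply: le_trans (ltW ltd).
by rewrite /tuple_dist (bigD1 k)//= le_max lexx.
Qed.

End Types.

(** * Isolation of types of tuples *)

Section TupleTypes.
Context {R : realType} {E : completeNormedModType R}.

Definition row_coef {n} (x : 'rV[R]_n) (i : nat) : R :=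
  if insub i is Some k then x 0 k else 0.

Lemma row_coefK n (x : 'rV[R]_n) : \row_i row_coef x i = x.
Proof. by apply/rowP => i; rewrite mxE /row_coef valK. Qed.

Lemma row_weightE n (x : nat -> R) : row_weight (\row_(i < n) x i) = weight n x.
Proof. by apply: eq_bigr => i _; rewrite mxE. Qed.

Definition tuple_type {F : normedModType R} (j : Emb E F) n (a : nat -> F) :
  ntype E n := tp j (fun i : 'I_n => a i).

Lemma tuple_typeE {F : normedModType R} (j : Emb E F) n (a : nat -> F) e
    (x : nat -> R) :
  type_norm (tuple_type j n a) (e, \row_(i < n) x i) = `|j e + lcomb n x a|.
Proof.
rewrite -[LHS]/(`|j e + \sum_(i < n) (\row_(i < n) x i) 0 i *: a i|).
by congr (`|_ + _|); apply: eq_bigr => i _; rewrite mxE.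
Qed.

Lemma type_close_tuple {F G : normedModType R} (j : Emb E F) (k : Emb E G)
    n a b d :
  type_close (tuple_type j n a) (tuple_type k n b) d <-> close_types j k n a b d.
Proof.
split=> [ab e x|ab [e x]].
  by have := ab (e, \row_i x i); rewrite /= row_weightE !tuple_typeE.
by rewrite -(row_coefK x) /= row_weightE !tuple_typeE.
Qed.

(** A basic neighbourhood of the type tests finitely many formal vectors; their
    components in [E] and a bound on their norms give the control. *)
Lemma isolated_controlled {F : normedModType R} (j : Emb E F) n (a : nat -> F) :
  isolated_type (tuple_type j n a) -> controlled j n a.
Proof.
move=> iso eta eta0; have /ntype_nbhsP[s [d d0 sP]] := iso eta eta0.
set xi := tuple_type j n a in sP *.
have xi0 z : 0 <= type_norm xi z := seminorm_ge0 (type_normP xi).1 z.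
pose M := 1 + \sum_(i < size s) type_norm xi (nth 0 s i).
have M0 : 0 < M by rewrite ltr_wpDr// sumr_ge0.
exists (size s), (fun i => (nth 0 s i).1), (d / M); split; first exact: divr_gt0.
move=> G psi c close; apply/type_close_tuple/type_dist_close/sP => z zs.
have zN : (index z s < size s)%N by rewrite index_mem.
have := close (unit_coef (index z s)) (row_coef z.2).
rewrite lcomb_unit// nth_index// -!tuple_typeE row_coefK -surjective_pairing -/xi.
rewrite distrC => /le_lt_trans; apply; rewrite mulrAC ltr_pdivrMr// ltr_pM2l//.
rewrite /M (bigD1 (Ordinal zN))//= nth_index// addrCA ltrDl.
by rewrite ltr_wpDr// sumr_ge0.
Qed.

(** By compactness of the unit cube, pointwise closeness of seminorms is
    uniform on finite-dimensional subspaces. *)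
Lemma uniform_type_nbhs n (xi : ntype E n) r (w : nat -> E * 'rV[R]_n) (d : R) :
  0 < d -> nbhs xi [set zeta : ntype E n | forall c,
    `|type_norm xi (lcomb r c w) - type_norm zeta (lcomb r c w)| <= d * weight r c].
Proof.
move=> d0; pose v (c : 'rV[R]_r) := lcomb r (row_coef c) w.
pose P (zeta : ntype E n) (c : 'rV[R]_r) :=
  `|type_norm xi (v c) - type_norm zeta (v c)| <= d.
pose cube := [set c : 'rV[R]_r | forall i, `[(-1) : R, 1]%classic (c 0 i)].
have vB c c' : v c - v c' = lcomb r (row_coef (c - c')) w.
  rewrite /v /lcomb -sumrB; apply: eq_bigr => i _.
  by rewrite -scalerBl /row_coef !valK !mxE.
suff near : nbhs xi [set zeta | cube `<=` P zeta].
  apply: filterS near => zeta zP c.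
  have wc := weight_ge0 r c; have [w0|w0] := eqVneq (weight r c) 0.
    have -> : lcomb r c w = 0.
      rewrite /lcomb big1// => i _; have : `|c i| <= 0.
        by rewrite -w0 /weight (bigD1 i)//= lerDl sumr_ge0.
      by rewrite normr_le0 => /eqP ->; rewrite scale0r.
    by rewrite !(type_normP _).2 normr0 subrr normr0 w0 mulr0.
  have {}w0 : 0 < weight r c by rewrite lt_def w0.
  have := zP (\row_i ((weight r c)^-1 * c i)); rewrite /P.
  have -> : v (\row_i ((weight r c)^-1 * c i)) = (weight r c)^-1 *: lcomb r c w.
    rewrite /v /lcomb scaler_sumr; apply: eq_bigr => i _.
    by rewrite /row_coef valK mxE scalerA.
  rewrite !(type_normP _).1.2 -mulrBr normrM normr_id.
  have winv : `|(weight r c)^-1| = (weight r c)^-1.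
    by apply: ger0_norm; rewrite invr_ge0.
  rewrite winv ler_pdivrMl// mulrC; apply.
  move=> i /=; rewrite mxE in_itv /= -ler_norml normrM winv.
  by rewrite ler_pdivrMl// mulr1 /weight (bigD1 i)//= lerDl sumr_ge0.
have /compact_near_coveringP : compact cube.
  apply: (@rV_compact _ _ (fun=> `[(-1) : R, 1]%classic)) => _.
  exact: segment_compact.
move=> cover; apply: (cover (ntype E n) (nbhs xi) P) => c0 _.
pose B := 1 + \sum_(i < r) (type_norm xi (w i) + 1).
have xi0 z : 0 <= type_norm xi z := seminorm_ge0 (type_normP xi).1 z.
have B0 : 0 < B by rewrite ltr_wpDr// sumr_ge0// => i _; rewrite addr_ge0.
have d3 : 0 < d / 3 by rewrite divr_gt0.
pose near_c := [set c : 'rV[R]_r | `|c - c0| < d / 3 / B].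
pose near_xi := [set zeta : ntype E n |
  `|type_norm xi (v c0) - type_norm zeta (v c0)| < d / 3 /\
  forall i : 'I_r, `|type_norm xi (w i) - type_norm zeta (w i)| < 1].
exists (near_c, near_xi); first split=> /=.
- apply/nbhs_ballP; exists (d / 3 / B); first by rewrite /= divr_gt0.
  by move=> c; rewrite -ball_normE /= /near_c /= distrC.
- apply/ntype_nbhsP; exists (v c0 :: [seq w i | i <- iota 0 r]), (Num.min (d / 3) 1).
    by rewrite lt_min d3 ltr01.
  move=> zeta zP; split.
    have := zP (v c0); rewrite mem_head => /(_ isT)/lt_le_trans; apply.
    by rewrite ge_min lexx.
  move=> i; have := zP (w i); rewrite in_cons map_f ?mem_iota ?add0n ?ltn_ord// orbT.
  by move=> /(_ isT)/lt_le_trans; apply; rewrite ge_min lexx orbT.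
move=> [c zeta] /= [cc0 [zc0 zw]]; rewrite /P /=.
have bound (theta : ntype E n) :
    (forall i : 'I_r, type_norm theta (w i) <= type_norm xi (w i) + 1) ->
    `|type_norm theta (v c) - type_norm theta (v c0)| <= d / 3.
  move=> tw; have ths := (type_normP theta).1; have [thD thZ] := ths.
  have le1 : type_norm theta (v c - v c0) <= d / 3.
    rewrite vB /lcomb; apply: (@le_trans _ _ (\sum_(i < r) `|c - c0| * (type_norm xi (w i) + 1))).
      elim/big_ind2: _ => [|x1 x2 y1 y2 h1 h2|i _].
      - by have := (type_normP theta).2 0; rewrite normr0 => ->.
      - by apply: (le_trans (thD _ _)); exact: lerD.
      rewrite thZ; apply: ler_pM => //; first exact: seminorm_ge0 ths _.
      rewrite /row_coef valK [leRHS]/Num.norm/= /mx_norm.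
      apply: (@le_trans _ _ `|(c - c0) 0 i|) => //.
      exact: (le_bigmax _ (fun ij => `|(c - c0) ij.1 ij.2|%:nng) (0, i)).
    rewrite -mulr_sumr; apply: (@le_trans _ _ (d / 3 / B * B)); last by rewrite divfK ?gt_eqF.
    apply: ler_pM => //; first by rewrite sumr_ge0// => i _; rewrite addr_ge0.
      exact: ltW.
    by rewrite lerDr.
  have hD x y : type_norm theta x - type_norm theta y <= type_norm theta (x - y).
    by rewrite lerBlDr -{1}(subrK y x).
  rewrite ler_norml; apply/andP; split; last exact: le_trans (hD _ _) le1.
  rewrite lerNl opprB; apply: le_trans (hD _ _) _.
  by rewrite -opprB (seminormN ths).
have h1 : `|type_norm xi (v c) - type_norm xi (v c0)| <= d / 3.
  by apply: bound => i; rewrite lerDl.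
have h2 : `|type_norm zeta (v c) - type_norm zeta (v c0)| <= d / 3.
  apply: bound => i; have := zw i; rewrite ltr_norml => /andP[]; lra.
move: h1 h2 zc0; rewrite !ler_norml ltr_norml => /andP[? ?] /andP[? ?] /andP[? ?].
by apply/andP; split; lra.
Qed.

End TupleTypes.

(** * The Polish space of embeddings and the action on it *)

Lemma separable_sequence {R : realType} (V : normedModType R) :
  separable_space V -> exists d : nat -> V, dense (range d).
Proof.
move=> [D Dc Dd]; have [|x [_ Dx]] := Dd setT _ openT; first by exists 0.
have /pfcard_geP[D0|[d]] := Dc; first by rewrite D0 in Dx.
exists d => O Oo oO; have [y [Oy Dy]] := Dd O Oo oO.
have [k _ dk] := 'surj_d Dy.
by exists y; split=> //; exists k.
Qed.

Lemma action_continuous {R : realType} (E G : normedModType R) :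
  continuous (fun p : Aut G * Emb E G => aut_act p.1 p.2 : Emb E G).
Proof.
suff main (s : Aut G) (f : Emb E G) (A : set (Emb E G)) :
    nbhs (aut_act s f) A -> nbhs (s, f) [set p | A (aut_act p.1 p.2)].
  by move=> [s f] A; exact: main.
move=> /emb_nbhsP[t [e e0 tA]].
have e2 := divr_gt0 e0 (ltr0Sn R 1).
exists ([set s' : Aut G | forall u, u \in [seq f x | x <- t] -> `|s u - s' u| < e / 2],
        [set f' : Emb E G | forall u, u \in t -> `|f u - f' u| < e / 2]).
  split=> /=; first by apply/aut_nbhsP; exists [seq f x | x <- t], (e / 2).
  by apply/emb_nbhsP; exists t, (e / 2).
move=> [s' f'] /= [ss' ff']; apply: tA => u ut /=.
rewrite -[aut_act _ _ u]/(s (f u)) -[aut_act _ _ u]/(s' (f' u)).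
rewrite -(subrKA (s' (f u))) (le_lt_trans (ler_normD _ _))// (splitr e) ltrD//.
  by apply: ss'; rewrite map_f.
have [[s'lin s'iso] _] := set_mem (valP s').
by rewrite -(linB s'lin) s'iso ff'.
Qed.

Section EmbPolish.
Context {R : realType} {E G : completeNormedModType R} (dE : nat -> E).
Context (ddE : dense (range dE)).
Implicit Types (f g : Emb E G).

Lemma emb_dist f g x y : `|f x - g x| <= `|f y - g y| + 2 * `|x - y|.
Proof.
have -> : f x - g x = (f y - g y) + (f (x - y) - g (x - y)).
  rewrite addrACA -opprD -(linD (emb_linear f)) -(linD (emb_linear g)).
  by rewrite [y + _]addrC subrK.
rewrite (le_trans (ler_normD _ _))// lerD2l (le_trans (ler_normB _ _))// !emb_norm.
lra.
Qed.

(** Isometries are equicontinuous, so their pointwise topology is determined on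
    a dense sequence. *)
Lemma emb_nbhs_denseP f (A : set (Emb E G)) :
  nbhs f A <-> exists N, forall g,
    (forall i, (i < N)%N -> `|f (dE i) - g (dE i)| < N.+1%:R^-1) -> A g.
Proof.
split=> [/emb_nbhsP[s [e e0 sA]]|[N NA]]; last first.
  apply/emb_nbhsP; exists [seq dE i | i <- iota 0 N], N.+1%:R^-1.
    by rewrite invr_gt0.
  by move=> g fg; apply: NA => i iN; apply: fg; rewrite map_f// mem_iota.
suff [N NP] : exists N, forall g,
    (forall i, (i < N)%N -> `|f (dE i) - g (dE i)| < N.+1%:R^-1) ->
    forall u, u \in s -> `|f u - g u| < e.
  by exists N => g /NP; exact: sA.
elim: s {sA} => [|u s [N NP]]; first by exists 0%N.
have e4 : 0 < e / 4 by rewrite divr_gt0.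
have [k uk] := dense_range_near u ddE e4; have [M ME] := natSinv_small e4.
pose L := maxn N (maxn k.+1 M).
have [NL [kL ML]] : (N <= L)%N /\ (k < L)%N /\ (M <= L)%N.
  by rewrite /L !leq_max !leqnn !orbT.
exists L => g fg v; rewrite in_cons => /predU1P[->|vs].
  apply: (le_lt_trans (emb_dist f g u (dE k))).
  have := lt_trans (fg k kL) (ME L ML); move: uk; lra.
apply: NP => // i iN; apply: (lt_le_trans (fg i (leq_trans iN NL))).
by rewrite lef_pV2 ?posrE// ler_nat ltnS.
Qed.

(** Cut off at [1 / (k + 1)], only finitely many gaps matter at each scale, and
    the supremum of all gaps metrises pointwise convergence. *)
Definition emb_gap f g k : R := Num.min k.+1%:R^-1 `|f (dE k) - g (dE k)|.

Definition emb_metric f g : R := sup (range (emb_gap f g)).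

Lemma emb_gap_ge0 f g k : 0 <= emb_gap f g k.
Proof. by rewrite le_min invr_ge0 ler0n normr_ge0. Qed.

Lemma emb_gap_le f g k : emb_gap f g k <= emb_metric f g.
Proof.
apply: ub_le_sup; last by exists k.
exists 1 => _ [i _ <-]; rewrite ge_min invf_le1 ?ltr0Sn// ler1n.
by rewrite ltn0Sn.
Qed.

Lemma emb_metric_le f g e : (forall k, emb_gap f g k <= e) -> emb_metric f g <= e.
Proof.
move=> h; apply: ge_sup; first by exists (emb_gap f g 0%N), 0%N.
by move=> _ [k _ <-].
Qed.

Lemma emb_metric_lt_small f g N : emb_metric f g < N.+1%:R^-1 ->
  forall i, (i < N)%N -> `|f (dE i) - g (dE i)| < N.+1%:R^-1.
Proof.
move=> h i iN; have := le_lt_trans (emb_gap_le f g i) h; rewrite gt_min => /orP[|//].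
by rewrite ltf_pV2 ?posrE// ltr_nat ltnS => /(ltn_trans iN); rewrite ltnn.
Qed.

Lemma emb_metric_small_lt f g (e : R) N : 0 < e ->
  (forall n, (N <= n)%N -> n.+1%:R^-1 < e) ->
  (forall i, (i < N)%N -> `|f (dE i) - g (dE i)| < e) -> emb_metric f g <= e.
Proof.
move=> e0 Ne h; apply: emb_metric_le => k; rewrite ge_min.
by have [kN|/Ne/ltW ->//] := ltnP k N; rewrite (ltW (h k kN)) orbT.
Qed.

Lemma emb_eq_dense f g : (forall k, f (dE k) = g (dE k)) -> f = g.
Proof.
move=> fg; apply: embP => x; apply/eqP; rewrite -subr_eq0 -normr_le0.
apply/ler_addgt0Pr => e e0; rewrite add0r.
have [k xk] := dense_range_near x ddE (divr_gt0 e0 (ltr0Sn R 1)).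
apply: (le_trans (emb_dist f g x (dE k))); rewrite fg subrr normr0 add0r; lra.
Qed.

Lemma emb_complete (u : nat -> Emb E G) :
  (forall k, cauchy_seq (fun n => u n (dE k))) -> exists l : Emb E G, u @ \oo --> l.
Proof.
move=> uc.
have ux x : cauchy_seq (fun n => u n x).
  move=> e e0; have e4 : 0 < e / 4 by rewrite divr_gt0.
  have [k xk] := dense_range_near x ddE e4; have [N Ne] := uc k _ e4.
  exists N => m n Nm Nn; apply: (le_lt_trans (emb_dist _ _ x (dE k))).
  have := Ne m n Nm Nn; move: xk; lra.
have /choice[l lP] x : exists l, seq_limit (fun n => u n x) l.
  exact: complete_seq_complete.
have liso : linear_isometry l.
  split=> [a x y|x].
    apply: (seq_limit_uniq (lP _)) => e e0.
    have a1 : 0 < `|a| + 1 by rewrite ltr_wpDl.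
    have e2 := divr_gt0 e0 (ltr0Sn R 1).
    have [N Ne] := lP x _ (divr_gt0 e2 a1); have [M Me] := lP y _ e2.
    exists (maxn N M) => n; rewrite geq_max => /andP[Nn Mn].
    rewrite emb_linear opprD addrACA -scalerBr (splitr e).
    rewrite (le_lt_trans (ler_normD _ _))// ltrD ?Me// normrZ.
    apply: (@le_lt_trans _ _ (`|u n x - l x| * (`|a| + 1))).
      by rewrite mulrC ler_wpM2l// lerDl.
    by rewrite -ltr_pdivlMr// Ne.
  apply/eqP; rewrite -subr_eq0 -normr_le0; apply/ler_addgt0Pr => e e0.
  have [N /(_ N (leqnn N)) Ne] := lP x e e0; rewrite add0r -(emb_norm (u N)).
  by apply: le_trans (ler_dist_dist _ _) _; rewrite distrC ltW.
exists (mk_emb liso) => A /emb_nbhsP[s [e e0 sA]].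
suff [N NP] : exists N, forall n, (N <= n)%N -> forall v, v \in s -> `|l v - u n v| < e.
  by exists N => // n Nn; apply: sA; exact: NP.
elim: s {sA} => [|v s [N NP]]; first by exists 0%N.
have [M Me] := lP v e e0; exists (maxn N M) => n; rewrite geq_max => /andP[Nn Mn] w.
by rewrite in_cons => /predU1P[->|/NP]; [rewrite distrC Me|exact].
Qed.

Lemma emb_metric_triangle f g h :
  emb_metric f h <= emb_metric f g + emb_metric g h.
Proof.
apply: emb_metric_le => k.
apply: (@le_trans _ _ (emb_gap f g k + emb_gap g h k)); last first.
  by apply: lerD; exact: emb_gap_le.
have := ler_distD (g (dE k)) (f (dE k)) (h (dE k)).
have := normr_ge0 (f (dE k) - g (dE k)); have := normr_ge0 (g (dE k) - h (dE k)).
have : (0 : R) <= k.+1%:R^-1 by rewrite invr_ge0.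
rewrite /emb_gap; move: k.+1%:R^-1 `|_| `|_| `|_| => r x y z.
rewrite ge_min => r0 z0 y0 xyz; apply/orP; case: (leP r y) => ?; case: (leP r z) => ?.
- by left; lra.
- by left; lra.
- by left; lra.
- by right; lra.
Qed.

Lemma emb_complete_metrization : complete_metrization emb_metric.
Proof.
split.
- move=> f g; split=> [fg|->].
    apply: emb_eq_dense => k; apply/eqP; rewrite -subr_eq0 -normr_le0.
    by have := emb_gap_le f g k; rewrite fg ge_min leNgt invr_gt0 ltr0Sn.
  apply/le_anti/andP; split; last exact: le_trans (emb_gap_ge0 g g 0) (emb_gap_le _ _ _).
  by apply: emb_metric_le => k; rewrite /emb_gap subrr normr0 ge_min lexx orbT.
- move=> f g; rewrite /emb_metric (_ : emb_gap f g = emb_gap g f)//.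
  by apply/funext => k; rewrite /emb_gap distrC.
- exact: emb_metric_triangle.
- move=> f A; rewrite emb_nbhs_denseP; split=> [[N NA]|[e e0 eA]].
    exists N.+1%:R^-1; first by rewrite invr_gt0.
    by move=> g /emb_metric_lt_small/NA.
  have e2 := divr_gt0 e0 (ltr0Sn R 1).
  have [N Ne] := natSinv_small e2; exists N => g fg; apply: eA => /=.
  apply: (@le_lt_trans _ _ (e / 2)); last lra.
  apply: (emb_metric_small_lt e2 Ne) => i iN; apply: (lt_trans (fg i iN)); exact: Ne.
- move=> u uc; apply: emb_complete => k e e0.
  pose e' := Num.min e k.+1%:R^-1.
  have [|N Ne] := uc e'; first by rewrite lt_min e0 invr_gt0 ltr0Sn.
  exists N => m n Nm Nn; have := le_lt_trans (emb_gap_le _ _ k) (Ne m n Nm Nn).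
  rewrite lt_min /emb_gap !gt_min ltxx /= => /andP[/orP[ke|//] lk].
  exact: lt_trans lk ke.
Qed.

(** One embedding is picked in each non-empty basic open set centred at finitely
    many values from the dense sequence of [G]; these sets are countably many. *)
Lemma emb_separable (dG : nat -> G) : dense (range dG) ->
  separable_space (Emb E G).
Proof.
move=> ddG; have [[f0 _]|noE] := pselect (exists f : Emb E G, True); last first.
  by exists set0 => // O [f Of]; case: noE; exists f.
pose C (c : seq nat * nat) := [set f : Emb E G | forall i, (i < size c.1)%N ->
  `|f (dE i) - dG (nth 0%N c.1 i)| < c.2.+1%:R^-1].
have /choice[p pP] c : exists f, C c !=set0 -> C c f.
  by have [[f Cf]|nC] := pselect (C c !=set0); [exists f|exists f0].
exists (range p).
  exact: sub_countable (card_image_le p setT) (countableP _).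
suff near (f : Emb E G) (O : set (Emb E G)) : nbhs f O -> O `&` range p !=set0.
  by move=> O [f Of] oO; apply: (near f); exact: open_nbhs_nbhs.
move=> nO; have /emb_nbhs_denseP[N NO]  := nO.
have /choice[t tP] i : exists m, `|f (dE i) - dG m| < (N.+1.*2).+1%:R^-1.
  by apply: dense_range_near => //; rewrite invr_gt0.
pose c := (mkseq t N, N.+1.*2).
have Cf : C c f.
  by move=> i; rewrite /= size_mkseq => iN; rewrite nth_mkseq.
have /(pP c) Cp : C c !=set0 by exists f.
exists (p c); split; last by exists c.
apply: NO => i iN; rewrite -(subrKA (dG (t i))) (le_lt_trans (ler_normD _ _))//.
have := tP i; have := Cp i; rewrite /= size_mkseq nth_mkseq// => /(_ iN).
rewrite [`|dG _ - _|]distrC => h1 h2; apply: (lt_trans (ltrD h2 h1)).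
have -> : (N.+1.*2).+1%:R = 2 * N.+1%:R + 1 :> R by rewrite -natr1 -mul2n natrM.
have : (0 : R) < N.+1%:R by [].
move: N.+1%:R => r r0; have -> : (2 * r + 1)^-1 + (2 * r + 1)^-1 = 2 / (2 * r + 1) by lra.
rewrite ltr_pdivrMr; last lra.
by rewrite mulrDr mulr1 mulrCA mulVf ?gt_eqF// mulr1 ltrDl invr_gt0.
Qed.

Lemma emb_polish (dG : nat -> G) : dense (range dG) -> polish R (Emb E G).
Proof.
move=> ddG; split; first exact: emb_separable ddG.
by exists emb_metric; exact: emb_complete_metrization.
Qed.

End EmbPolish.

(** * Orbits of atomic and of non-atomic embeddings *)

Section Composition.
Context {R : realType}.

Lemma comp_emb_isometry {E H G : normedModType R} (s : Emb H G) (f : Emb E H) :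
  linear_isometry (s \o f).
Proof.
split=> [a x y|x] /=; first by rewrite !emb_linear.
by rewrite !emb_norm.
Qed.

Definition comp_emb {E H G : normedModType R} (s : Emb H G) (f : Emb E H) :
  Emb E G := mk_emb (comp_emb_isometry s f).

Lemma aut_of_emb {G : normedModType R} (s : Emb G G) : bijective s ->
  exists t : Aut G, t =1 s.
Proof.
move=> sb; have sP : [set f : {ptws G -> G} | linear_isometry f /\ bijective f] s.
  by split=> //; exact: set_mem (valP s).
by exists (exist _ (s : {ptws G -> G}) (mem_set sP)).
Qed.

Lemma emb_of_aut {G : normedModType R} (t : Aut G) :
  exists2 s : Emb G G, bijective s & t =1 s.
Proof.
have [tiso tb] := set_mem (valP t).
by exists (mk_emb (tiso : linear_isometry (t : G -> G))).
Qed.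

(** An isometry onto [G] carries a tuple back to one with the same type. *)
Lemma atomic_comp {E H G : completeNormedModType R} (s : Emb H G) (f : Emb E H) :
  bijective s -> atomic_over f -> atomic_over (comp_emb s f).
Proof.
move=> [t sK tK] fa n a.
have -> : tp (comp_emb s f) a = tp f (t \o a); last exact: fa.
apply: ntypeP => -[e x].
rewrite -[LHS]/(`|s (f e) + \sum_(k < n) x 0 k *: a k|).
rewrite -[RHS]/(`|f e + \sum_(k < n) x 0 k *: t (a k)|) -[RHS](emb_norm s).
rewrite (linD (emb_linear s)) (lin_sum (emb_linear s)).
congr (`|_ + _|); apply: eq_bigr => k _.
by rewrite (linZ (emb_linear s)) tK.
Qed.

Lemma atomic_orbit {E G : completeNormedModType R} (f g : Emb E G) :
  atomic_over f -> emb_orbit f g -> atomic_over g.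
Proof.
move=> fa [t _ <-]; have [s sb ts] := emb_of_aut t.
have -> : aut_act t f = comp_emb s f by apply: embP => x; exact: ts.
exact: atomic_comp.
Qed.

End Composition.

Section TypeTopology.
Context {R : realType} {E : completeNormedModType R}.

Lemma type_realized n (zeta : ntype E n) :
  exists (K : completeNormedModType R) (j : Emb E K) (c : nat -> K),
    tuple_type j n c = zeta.
Proof.
have [K [i [ilin inorm]]] := seminorm_realize (type_normP zeta).1.
exists K, (mk_emb (type_emb_isometry ilin inorm)).
exists (fun k => if insub k is Some k' then i (0, 'e_k') else 0).
rewrite /tuple_type.
have -> : (fun k : 'I_n => if insub (k : nat) is Some k' then i (0, 'e_k') else 0)
    = (fun k => i (0, 'e_k)) by apply/funext => k; rewrite valK.
exact: (realized_type ilin inorm).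
Qed.

Lemma uniform_tuple_nbhs n (xi : ntype E n) m (e : nat -> E) (d : R) : 0 < d ->
  nbhs xi [set zeta : ntype E n | forall y (x : nat -> R),
    `|type_norm xi (lcomb m y e, \row_(i < n) x i)
      - type_norm zeta (lcomb m y e, \row_(i < n) x i)|
    <= d * (weight m y + weight n x)].
Proof.
move=> d0; pose w i : E * 'rV[R]_n := if (i < m)%N then (e i, 0) else
  (0, if insub (i - m)%N is Some k then 'e_k else 0).
apply: filterS (uniform_type_nbhs xi (m + n) w d0) => zeta zP y x.
pose c i := if (i < m)%N then y i else x (i - m)%N.
have cl i : (i < m)%N -> c i = y i by rewrite /c => ->.
have cr i : c (m + i)%N = x i by rewrite /c ltnNge leq_addr addKn.
have sum_pair (I : finType) (F : I -> E * 'rV[R]_n) :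
    \sum_i F i = (\sum_i (F i).1, \sum_i (F i).2).
  by elim/big_rec3: _ => // k u v t _ ->.
have -> : (lcomb m y e, \row_(i < n) x i) = lcomb (m + n) c w.
  rewrite /lcomb big_split_ord /= sum_pair sum_pair; apply/pair_equal_spec; split=> /=.
    rewrite [X in _ + X]big1 ?addr0; last first.
      by move=> i _; rewrite /w ltnNge leq_addr /= scaler0.
    by apply: eq_bigr => i _; rewrite /w /c ltn_ord.
  rewrite big1 ?add0r; last by move=> i _; rewrite /w ltn_ord /= scaler0.
  rewrite [LHS]row_sum_delta; apply: eq_bigr => i _.
  by rewrite mxE cr /w ltnNge leq_addr /= addKn valK.
have <- : weight (m + n) c = weight m y + weight n x.
  rewrite /weight big_split_ord; congr (_ + _); apply: eq_bigr => i _ /=.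
    by rewrite cl.
  by rewrite cr.
exact: zP.
Qed.

Lemma tuple_type_near {G : normedModType R} (phi : Emb E G) n (a : nat -> G)
    (A : set (ntype E n)) : nbhs (tuple_type phi n a) A ->
  nbhs phi [set psi : Emb E G | A (tuple_type psi n a)].
Proof.
move=> /ntype_nbhsP[s [e e0 sA]]; apply/emb_nbhsP; exists [seq z.1 | z <- s], e => //.
move=> psi near; apply: sA => -[v x] zs.
apply: le_lt_trans (near v _); last by apply/mapP; exists (v, x).
rewrite -[type_norm _ _]/(`|phi v + \sum_(i < n) x 0 i *: a i|).
rewrite -[type_norm (tuple_type psi n a) _]/(`|psi v + \sum_(i < n) x 0 i *: a i|).
by apply: (le_trans (ler_dist_dist _ _)); rewrite opprD addrACA subrr addr0.
Qed.

Lemma eq_tuple_type {G : normedModType R} (phi : Emb E G) n (a b : nat -> G) :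
  (forall i, (i < n)%N -> a i = b i) -> tuple_type phi n a = tuple_type phi n b.
Proof.
by move=> ab; congr tp; apply/funext => i; exact: ab.
Qed.

Lemma tp_tuple_type {G : normedModType R} (phi : Emb E G) n (a : 'I_n -> G) :
  tuple_type phi n (fun i => if insub i is Some k then a k else 0) = tp phi a.
Proof. by congr tp; apply/funext => i; rewrite valK. Qed.

End TypeTopology.

Section Gurarij.
Context {R : realType} {G : completeNormedModType R} (gurG : gurarij G).
Context (dG : nat -> G) (ddG : dense (range dG)).

Lemma close_types_nil {E H K : normedModType R} (phi : Emb E H) (psi : Emb E K)
    a b d : close_types phi psi 0 a b d.
Proof.
move=> e x; rewrite /lcomb /weight !big_ord0 !addr0 !emb_norm subrr normr0.
by rewrite mulr0.
Qed.

(** Back-and-forth over the zero space, from empty tuples. *)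
Lemma gurarij_unique (H : completeNormedModType R) (dH : nat -> H) :
  gurarij H -> dense (range dH) -> exists s : Emb H G, bijective s.
Proof.
move=> gurH ddH.
have [s sb _] := back_and_forth gurH gurG ddH ddG
  (fun n a _ => controlled_trivial (zero_emb G H) n a (@zero_spaceE _ _))
  (fun n a _ => controlled_trivial (zero_emb G G) n a (@zero_spaceE _ _))
  (d := 1) ltr01 (close_types_nil _ _ (fun=> 0) (fun=> 0) 1).
by exists s.
Qed.

Context {E : completeNormedModType R} (dE : nat -> E) (ddE : dense (range dE)).
Implicit Types (phi psi : Emb E G).

(** The images of finitely many points of [E] under two embeddings have the same
    type over the zero space, so an automorphism almost matches them. *)
Lemma emb_orbit_dense phi : dense (emb_orbit phi).
Proof.
suff near psi (O : set (Emb E G)) : nbhs psi O -> O `&` emb_orbit phi !=set0.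
  by move=> O [psi Opsi] oO; apply: (near psi); exact: open_nbhs_nbhs.
move=> /(emb_nbhs_denseP ddE)[N NO].
(* 27 exceeds the constant 26 of the back-and-forth. *)
have [d d0 dN] : exists2 d : R, 0 < d & d * 27 = N.+1%:R^-1.
  by exists (N.+1%:R^-1 / 27); rewrite ?divfK// divr_gt0// invr_gt0.
have [|s sb [_ sP]] := back_and_forth gurG gurG ddG ddG
  (fun n a _ => controlled_trivial (zero_emb G G) n a (@zero_spaceE _ _))
  (fun n a _ => controlled_trivial (zero_emb G G) n a (@zero_spaceE _ _))
  (n := N) (a := phi \o dE) (b := psi \o dE) d0.
  move=> e x; rewrite !zero_embE !add0r.
  rewrite -(lin_lcomb _ _ _ (emb_linear phi)) -(lin_lcomb _ _ _ (emb_linear psi)).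
  by rewrite !emb_norm subrr normr0 mulr_ge0 ?weight_ge0// ltW.
have [t ts] := aut_of_emb sb; exists (aut_act t phi); split; last by exists t.
apply: NO => i iN; rewrite distrC -[aut_act t phi _]/(t (phi (dE i))) ts.
by apply: (le_lt_trans (sP i iN)); rewrite -dN; lra.
Qed.

Definition dense_tuple (c : seq nat) (i : nat) : G := dG (nth 0%N c i).

(** Isolation tested on countably many tuples. It suffices for the
    back-and-forth, so it defines a single orbit; as soon as some embedding is
    atomic, this is the orbit of the atomic ones. *)
Definition densely_isolated phi := forall n c,
  isolated_type (tuple_type phi n (dense_tuple c)).

Lemma densely_isolated_controlled phi n a : densely_isolated phi ->
  tuple_in dG n a -> controlled phi n a.
Proof.
move=> iso aG; have /choice[f fP] i : exists m, (i < n)%N -> dG m = a i.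
  by have [/aG[m _ ma]|_] := ltnP i n; [exists m|exists 0%N].
apply: isolated_controlled.
rewrite (@eq_tuple_type _ _ _ _ _ _ (dense_tuple (mkseq f n))) => [|i iN]; first exact: iso.
by rewrite /dense_tuple nth_mkseq// fP.
Qed.

Lemma densely_isolated_orbit phi psi : densely_isolated phi ->
  densely_isolated psi -> emb_orbit phi psi.
Proof.
move=> phi_iso psi_iso.
have [s sb [sphi _]] := back_and_forth gurG gurG ddG ddG
  (fun n a => densely_isolated_controlled phi_iso)
  (fun n a => densely_isolated_controlled psi_iso)
  (d := 1) ltr01 (close_types_nil phi psi (fun=> 0) (fun=> 0) 1).
have [t ts] := aut_of_emb sb; exists t => //.
by apply: embP => e; rewrite -sphi -ts.
Qed.

Lemma atomic_densely_isolated phi : atomic_over phi -> densely_isolated phi.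
Proof. by move=> at_ n c; exact: at_. Qed.

Lemma atomic_orbitE phi0 : atomic_over phi0 ->
  [set phi : Emb E G | atomic_over phi] = emb_orbit phi0.
Proof.
move=> at0; apply/seteqP; split=> phi /=; last exact: atomic_orbit.
by move=> /atomic_densely_isolated; apply: densely_isolated_orbit; exact: atomic_densely_isolated.
Qed.

(** A type is isolated exactly when it has neighbourhoods of arbitrarily small
    diameter, a countable intersection of open conditions. *)
Definition small_type_nbhd n (l : nat) (xi : ntype E n) :=
  exists2 A, nbhs xi A & forall zeta theta, A zeta -> A theta ->
    type_close zeta theta l.+1%:R^-1.

Lemma isolated_small_nbhd n (xi : ntype E n) :
  isolated_type xi <-> forall l, small_type_nbhd l xi.
Proof.
split=> [iso l|small e e0].
  have h0 : 0 < (l.+1%:R^-1 : R) / 2 by rewrite divr_gt0// invr_gt0.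
  exists [set zeta | (type_dist xi zeta < (l.+1%:R^-1 / 2)%:E)%E]; first exact: iso.
  move=> zeta theta /type_dist_close hz /type_dist_close ht; rewrite [l.+1%:R^-1]splitr.
  by apply: type_close_trans ht; exact: type_close_sym.
have [l /(_ l (leqnn l)) le] := natSinv_small e0; have [A nA Ac] := small l.
have Axi := nbhs_singleton nA.
apply: filterS nA => zeta Az /=; apply: le_lt_trans (_ : (l.+1%:R^-1)%:E < _)%E.
  apply: type_dist_le; first by rewrite invr_ge0 ler0n.
  exact: Ac.
by rewrite lte_fin.
Qed.

Lemma open_small_nbhd n c l :
  open [set phi : Emb E G | small_type_nbhd l (tuple_type phi n (dense_tuple c))].
Proof.
rewrite openE => phi [A nA Ac].
have : nbhs (tuple_type phi n (dense_tuple c)) (interior A) by exact: nbhs_interior.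
by move=> /tuple_type_near; apply: filterS => psi Apsi; exists A.
Qed.

Lemma densely_isolated_Gdelta : Gdelta densely_isolated.
Proof.
pose F (k : nat) : set (Emb E G) :=
  if unpickle k is Some (n, c, l) then
    [set phi : Emb E G | small_type_nbhd l (tuple_type phi n (dense_tuple c))]
  else setT.
exists F => [k|].
  by rewrite /F; case: unpickle => [[[n c] l]|]; [exact: open_small_nbhd|exact: openT].
apply/seteqP; split=> [phi iso k _|phi Fphi n c].
  by rewrite /F; case: unpickle => [[[n c] l]|//]; apply: (isolated_small_nbhd _).1.
apply/isolated_small_nbhd => l; have := Fphi (pickle (n, c, l)) I.
by rewrite /F pickleK.
Qed.

(** If the embeddings realising [xi] near a fixed tuple were somewhere dense,
    realising types close to [xi] in extensions of [E] and embedding these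
    extensions in [G] would show [xi] to be isolated. *)
Lemma realizing_nowhere_dense n (xi : ntype E n) (b : nat -> G) (e : R) : 0 < e ->
  ~ nbhs xi [set zeta | (type_dist xi zeta < e%:E)%E] ->
  nowhere_dense [set psi : Emb E G | exists2 b', tuple_type psi n b' = xi &
    forall i, (i < n)%N -> `|b' i - b i| <= e / 4].
Proof.
move=> e0 noniso; set N := [set psi | _].
have closed_cond psi : closure N psi -> type_close (tuple_type psi n b) xi (e / 4).
  move=> cpsi [v x]; rewrite -(row_coefK x); set x' := row_coef x.
  rewrite tuple_typeE /= row_weightE; apply/ler_addgt0Pr => d d0.
  have : nbhs psi [set psi' : Emb E G | `|psi v - psi' v| < d].
    apply/emb_nbhsP; exists [:: v], d => // g; apply; exact: mem_head.
  move=> /cpsi[psi' [[b' <- bb'] near]]; rewrite tuple_typeE.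
  apply: (le_trans (ler_dist_dist _ _)); rewrite opprD addrACA addrC.
  rewrite (le_trans (ler_normD _ _))// lerD//; last exact: ltW.
  by rewrite distrC; exact: lcomb_dist.
apply/seteqP; split=> // psi1 npsi1; apply: noniso.
have [psi0 [Npsi0 npsi0]] : N `&` interior (closure N) !=set0.
  by apply: (interior_subset npsi1); exact: nbhs_interior.
have [M MN] := (emb_nbhs_denseP ddE psi0 (closure N)).1 npsi0.
have [b' b'xi b'b] := Npsi0.
(* The embeddings found below move the test points by [4 * d], which must be
   strictly less than the radius [1 / (M + 1)]. *)
pose d := Num.min (M.+1%:R^-1) (e / 4) / 8.
have m0 : 0 < Num.min (M.+1%:R^-1) (e / 4) by rewrite lt_min invr_gt0 ltr0Sn divr_gt0.
have d0 : 0 < d by rewrite divr_gt0.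
have d8 : 8 * d = Num.min (M.+1%:R^-1) (e / 4) by rewrite mulrC divfK.
have dM : 4 * d < M.+1%:R^-1.
  by apply: (@lt_le_trans _ _ (8 * d)); [move: d0; lra|rewrite d8 ge_min lexx].
have de : 4 * d <= e / 4.
  by apply: (@le_trans _ _ (8 * d)); [move: d0; lra|rewrite d8 ge_min lexx orbT].
apply: filterS (uniform_tuple_nbhs xi M dE d0) => zeta near /=.
have [K [j [c czeta]]] := type_realized zeta.
have [|psi [c' [psiE psinear cnear]]] := gurarij_universal gurG (psi0 := psi0)
  (m := M) (e := dE) (n := n) (j := j) (c := c) (b := b') ddE d0.
  by move=> y x; rewrite distrC -!tuple_typeE b'xi czeta; exact: near.
have zetaE : tuple_type psi n c' = zeta.
  rewrite -czeta; apply: ntypeP => -[v x].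
  by rewrite -(row_coefK x) !tuple_typeE psiE.
have /closed_cond psib : closure N psi.
  by apply: MN => i iM; rewrite distrC; exact: le_lt_trans (psinear i iM) dM.
apply: (@le_lt_trans _ _ (e / 4 + (e / 4 + e / 4))%:E); last by rewrite lte_fin; lra.
apply: type_dist_le; first lra.
apply: type_close_trans (type_close_sym psib) _; rewrite -zetaE.
apply/type_close_tuple => v x.
apply: (le_trans (ler_dist_dist _ _)); rewrite opprD addrACA subrr add0r.
apply: lcomb_dist => i iN; rewrite distrC -(subrKA (b' i)).
by rewrite (le_trans (ler_normD _ _))// lerD ?b'b// (le_trans (cnear i iN)).
Qed.

(** Every embedding in the orbit of [phi] realises the same non-isolated type,
    near one of countably many tuples. *)
Lemma nonatomic_orbit_meagre phi : ~ atomic_over phi -> meagre (emb_orbit phi).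
Proof.
move=> nat_; have [n [a [e [e0 noniso]]]] : exists n (a : 'I_n -> G) (e : R),
    0 < e /\ ~ nbhs (tp phi a) [set zeta | (type_dist (tp phi a) zeta < e%:E)%E].
  apply: contrapT => no; apply: nat_ => n a e e0; apply: contrapT => nn.
  by apply: no; exists n, a, e.
pose xi := tp phi a; pose N (c : seq nat) := [set psi : Emb E G |
  exists2 b', tuple_type psi n b' = xi &
    forall i, (i < n)%N -> `|b' i - dense_tuple c i| <= e / 4].
exists (fun k => if unpickle k is Some c then N c else set0) => [k|].
  case: unpickle => [c|]; first exact: realizing_nowhere_dense.
  by rewrite /nowhere_dense closure0 interior0.
move=> _ [t _ <-]; have [s _ ts] := emb_of_aut t.
pose b i := s (if insub i is Some k then a k else 0).
have /choice[f fP] i : exists m, `|b i - dG m| < e / 4.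
  by apply: dense_range_near => //; rewrite divr_gt0.
exists (pickle (mkseq f n)) => //; rewrite pickleK; exists b.
  rewrite /xi -tp_tuple_type; apply: ntypeP => -[v x]; rewrite -(row_coefK x) !tuple_typeE.
  rewrite -[aut_act t phi v]/(t (phi v)) ts -[LHS]/(`|s (phi v) + lcomb n (row_coef x) (s \o _)|).
  by rewrite -(lin_lcomb _ _ _ (emb_linear s)) -(linD (emb_linear s)) emb_norm.
by move=> i iN; rewrite /dense_tuple nth_mkseq// ltW.
Qed.

End Gurarij.

(** * Generic orbits *)

Theorem corollary2p10 (R : realType) (E G : completeNormedModType R)
    (sepE : separable_space E)
    (sepG : separable_space G) (gurG : gurarij G) :
  [/\ polish R (Emb E G),
      continuous (fun p : Aut G * Emb E G => aut_act p.1 p.2 : Emb E G) &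
      forall phi : Emb E G, dense (emb_orbit phi)]
  /\ (atomic_gurarij_exists E ->
       exists phi0 : Emb E G,
         [/\ [set phi : Emb E G | atomic_over phi] = emb_orbit phi0,
             dense [set phi : Emb E G | atomic_over phi] &
             Gdelta [set phi : Emb E G | atomic_over phi]])
  /\ (~ atomic_gurarij_exists E ->
       (forall phi : Emb E G, ~ atomic_over phi) /\
       (forall phi : Emb E G, meagre (emb_orbit phi))).
Proof.
have [dE ddE] := separable_sequence sepE; have [dG ddG] := separable_sequence sepG.
split; first split.
- exact: (emb_polish ddE ddG).
- exact: action_continuous.
- by move=> phi; exact: (emb_orbit_dense gurG ddG ddE).
split=> [[H [j [sepH gurH jat]]]|noat].
  have [dH ddH] := separable_sequence sepH.
  have [s sb] := gurarij_unique gurG ddG gurH ddH.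
  have at0 : atomic_over (comp_emb s j) by exact: atomic_comp.
  exists (comp_emb s j); split.
  - exact: (atomic_orbitE gurG ddG).
  - by rewrite (atomic_orbitE gurG ddG at0); exact: (emb_orbit_dense gurG ddG ddE).
  - suff -> : [set phi : Emb E G | atomic_over phi] = densely_isolated dG.
      exact: densely_isolated_Gdelta.
    apply/seteqP; split=> phi /=; first exact: atomic_densely_isolated.
    move=> iso; apply: (atomic_orbit at0).
    exact: (densely_isolated_orbit gurG ddG (atomic_densely_isolated dG at0) iso).
have no phi : ~ atomic_over (phi : Emb E G) by move=> at_; apply: noat; exists G, phi.
by split=> // phi; exact: (nonatomic_orbit_meagre gurG ddG ddE (no phi)).
Qed.
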